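(* Let $p$ be an odd prime, let $n\ge 3$ be an odd integer, and let $f:\mathbb{F}_p^n\to\mathbb{F}_p$ be a non-weakly regular bent function belonging to $\mathcal{DBF}$. If $p\equiv1\pmod4$, assume that $B_+(f)$ and $B_+(f^* )$ are both non-degenerate $r$-dimensional subspaces over $\mathbb{F}_p$; if $p\equiv3\pmod 4$, assume that $B_-(f)$ and $B_+(f^* )$ are both non-degenerate $r$-dimensional subspaces over $\mathbb{F}_p$. (i) If $r=\frac{n+1}2$ and $p\equiv1\pmod4$, then $$U_{10}=\{\{0\},\ c_0(f)\setminus\{0\},\ c_{s_1}(f),c_{s_2}(f),\dots,c_{s_{(p-1)/2}}(f),\ d_0(f),d_1(f),\dots,d_{p-1}(f)\}$$ is a partition of $\mathbb{F}_p^n$ and induces a $\frac{3p+1}2$-class symmetric association scheme. (ii) If $r=\frac{n+1}2$ and $p\equiv3\pmod4$, then $$U_{11}=\{\{0\},\ c_0(f)\setminus\{0\},\ c_{n_1}(f),c_{n_2}(f),\dots,c_{n_{(p-1)/2}}(f),\ d_0(f),d_1(f),\dots,d_{p-1}(f)\}$$ is a partition of $\mathbb{F}_p^n$ and induces a $\frac{3p+1}2$-class symmetric association scheme. (iii) If $\frac{n+1}2<r\le n-1$ and $p\equiv1\pmod4$, then $$U_{12}=\{\{0\},\ B_+(f)^\bot\setminus\{0\},\ c_0(f)\setminus B_+(f)^\bot,\ c_1(f),\dots,c_{p-1}(f),\ d_0(f),d_1(f),\dots,d_{p-1}(f)\}$$ is a partition of $\mathbb{F}_p^n$ and induces a $(2p+1)$-class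 symmetric association scheme. (iv) If $\frac{n+1}2<r\le n-1$ and $p\equiv3\pmod4$, then $$U_{13}=\{\{0\},\ B_-(f)^\bot\setminus\{0\},\ c_0(f)\setminus B_-(f)^\bot,\ c_1(f),\dots,c_{p-1}(f),\ d_0(f),d_1(f),\dots,d_{p-1}(f)\}$$ is a partition of $\mathbb{F}_p^n$ and induces a $(2p+1)$-class symmetric association scheme.
   Context: Let $p$ be an odd prime, $n$ a positive integer, $x\cdot y$ the ordinary inner product on $\mathbb{F}_p^n$, and $\xi_p=e^{2\pi\sqrt{-1}/p}$. $SQ=\{s_1<s_2<\dots<s_{(p-1)/2}\}$ and $NSQ=\{n_1<n_2<\dots<n_{(p-1)/2}\}$ denote the sets of squares and of nonsquares in $\mathbb{F}_p^*=\{1,\dots,p-1\}$. Bent functions. For $f:\mathbb{F}_p^n\to\mathbb{F}_p$ the Walsh transform is $\mathcal{W}_f(\alpha)=\sum_{x\in\mathbb{F}_p^n}\xi_p^{f(x)-\alpha\cdot x}$, $\alpha\in\mathbb{F}_p^n$; $f$ is bent if $|\mathcal{W}_f(\alpha)|=p^{n/2}$ for all $\alpha$. Put $\mu=1$ if $p^n\equiv1\pmod 4$ and $\mu=\sqrt{-1}$ if $p^n\equiv3\pmod4$. For a bent $f$ it is known that for every $\alpha$, $\mathcal{W}_f(\alpha)\in\{\mu p^{n/2}\xi_p^{f^*(\alpha)},-\mu p^{n/2}\xi_p^{f^*(\alpha)}\}$ for a (unique) function $f^*:\mathbb{F}_p^n\to\mathbb{F}_p$, called the dual of $f$. A bent $f$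 is weakly regular if there is $\lambda\in\{\pm1,\pm\sqrt{-1}\}$ independent of $\alpha$ with $\mathcal{W}_f(\alpha)=\lambda p^{n/2}\xi_p^{f^*(\alpha)}$ for all $\alpha$; otherwise it is non-weakly regular. A bent $f$ is dual-bent if $f^*$ is also bent. For a bent function $f$: $B_+(f)=\{\alpha:\mathcal{W}_f(\alpha)=\mu p^{n/2}\xi_p^{f^*(\alpha)}\}$ and $B_-(f)=\{\alpha:\mathcal{W}_f(\alpha)=-\mu p^{n/2}\xi_p^{f^*(\alpha)}\}$. For $f$ dual-bent, $B_\pm(f^* )$ are defined by the same formulas applied to the bent function $f^*$. For dual-bent $f$ and $j\in\mathbb{F}_p$: $c_j(f)=\{x\in B_+(f^* ):f(x)=j\}$, $d_j(f)=\{x\in B_-(f^* ):f(x)=j\}$. $\mathcal{DBF}$ is the set of dual-bent functions $f:\mathbb{F}_p^n\to\mathbb{F}_p$ such that $f(0)=0$ and there is a positive integer $h$ with $\gcd(h-1,p-1)=1$ and $f(ax)=a^hf(x)$ for all $a\in\mathbb{F}_p^*$, $x\in\mathbb{F}_p^n$. For a subspace $V$ of $\mathbb{F}_p^n$, $V^\bot$ is its orthogonal complement with respect to $\cdot$; $V$ is non-degenerate if $\{x\in V:x\cdot y=0\ \text{for all } y\in V\}=\{0\}$. Association schemes. A $d$-class association scheme on a nonempty finite set $X$ is a partition of $X\times X$ into relations $R_0,\dots,R_d$ such that $R_0=\{(x,x):x\in X\}$; for each $j$ the transpose $R_j^T$ equals some $R_{j'}$; and for all $u,v,w$ and $(x,y)\in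 R_w$ the number $|\{z\in X:(x,z)\in R_u,(z,y)\in R_v\}|$ depends only on $u,v,w$. It is symmetric if $R_j^T=R_j$ for all $j$. A partition $\{U_i\}_{i=0}^d$ of $\mathbb{F}_p^n$ (into nonempty sets) with $U_0=\{0\}$ induces a $d$-class symmetric association scheme if the relations $R_i=\{(\alpha,\beta):\alpha-\beta\in U_i\}$, $0\le i\le d$, form a symmetric association scheme on $\mathbb{F}_p^n$. *)

(* Defs.v *)
From mathcomp Require Import all_boot all_order all_algebra.
From mathcomp Require Import all_reals all_analysis.
From mathcomp Require Import complex.

Set Implicit Arguments.
Unset Strict Implicit.
Unset Printing Implicit Defensive.

Import Order.TTheory GRing.Theory Num.Theory.

Local Open Scope ring_scope.

Definition dot (p n : nat) (x y : 'rV['F_p]_n) : 'F_p :=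
  \sum_(i < n) x 0 i * y 0 i.

Definition xi (R : realType) (p : nat) : R[i] :=
  (cos (2 * pi / p%:R) +i* sin (2 * pi / p%:R))%C.

Definition half_pow (R : realType) (p n : nat) : R[i] :=
  sqrtC (p%:R ^+ n).

(* Only used for odd p, where p ^ n is 1 or 3 modulo 4. *)
Definition mu (R : realType) (p n : nat) : R[i] :=
  if (p ^ n %% 4)%N == 1%N then 1 else (0 +i* 1)%C.

(* The exponent is the representative in [0, p-1] of an element of 'F_p. *)
Definition walsh (R : realType) (p n : nat) (f : 'rV['F_p]_n -> 'F_p)
    (a : 'rV['F_p]_n) : R[i] :=
  \sum_(x : 'rV['F_p]_n) xi R p ^+ (f x - dot a x)%R.

Definition bent (R : realType) (p n : nat) (f : 'rV['F_p]_n -> 'F_p) : Prop :=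
  forall a, `|walsh R f a| = half_pow R p n.

(* For p an odd prime and f bent, the j picked below always exists and is
   unique; the default value 0 is only reached outside of that case. *)
Definition dual (R : realType) (p n : nat) (f : 'rV['F_p]_n -> 'F_p)
    (a : 'rV['F_p]_n) : 'F_p :=
  odflt 0 [pick j : 'F_p |
    (walsh R f a == mu R p n * half_pow R p n * xi R p ^+ j) ||
    (walsh R f a == - (mu R p n * half_pow R p n * xi R p ^+ j))].

Definition weakly_regular (R : realType) (p n : nat)
    (f : 'rV['F_p]_n -> 'F_p) : Prop :=
  bent R f /\
  exists2 lambda : R[i],
    lambda \in [:: 1; -1; (0 +i* 1)%C; - (0 +i* 1)%C] &
    forall a, walsh R f a = lambda * half_pow R p n * xi R p ^+ dual R f a.

Definition non_weakly_regular (R : realType) (p n : nat)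
    (f : 'rV['F_p]_n -> 'F_p) : Prop :=
  bent R f /\ ~ weakly_regular R f.

Definition dual_bent (R : realType) (p n : nat)
    (f : 'rV['F_p]_n -> 'F_p) : Prop :=
  bent R f /\ bent R (dual R f).

Definition Bplus (R : realType) (p n : nat) (f : 'rV['F_p]_n -> 'F_p) :
    {set 'rV['F_p]_n} :=
  [set a | walsh R f a == mu R p n * half_pow R p n * xi R p ^+ dual R f a].

Definition Bminus (R : realType) (p n : nat) (f : 'rV['F_p]_n -> 'F_p) :
    {set 'rV['F_p]_n} :=
  [set a | walsh R f a == - (mu R p n * half_pow R p n * xi R p ^+ dual R f a)].

Definition cset (R : realType) (p n : nat) (f : 'rV['F_p]_n -> 'F_p)
    (j : 'F_p) : {set 'rV['F_p]_n} :=
  [set x in Bplus R (dual R f) | f x == j].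

Definition dset (R : realType) (p n : nat) (f : 'rV['F_p]_n -> 'F_p)
    (j : 'F_p) : {set 'rV['F_p]_n} :=
  [set x in Bminus R (dual R f) | f x == j].

Definition DBF (R : realType) (p n : nat) (f : 'rV['F_p]_n -> 'F_p) : Prop :=
  [/\ dual_bent R f,
      f 0 = 0 &
      exists h : nat,
        [/\ (0 < h)%N, gcdn (h - 1) (p - 1) = 1%N &
            forall (a : 'F_p) (x : 'rV['F_p]_n),
              a != 0 -> f (a *: x) = a ^+ h * f x]].

Definition orthc (p n : nat) (S : {set 'rV['F_p]_n}) : {set 'rV['F_p]_n} :=
  [set x | [forall y in S, dot x y == 0]].

Definition is_nondegenerate_subspace (p n r : nat)
    (S : {set 'rV['F_p]_n}) : Prop :=
  exists V : {vspace 'rV['F_p]_n},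
    [/\ S = [set x | x \in V], \dim V = r &
        [set x in S | [forall y in S, dot x y == 0]] = [set 0]].

Definition squares (p : nat) : {set 'F_p} :=
  [set a | (a != 0) && [exists b : 'F_p, a == b ^+ 2]].

Definition nonsquares (p : nat) : {set 'F_p} :=
  [set a | (a != 0) && ~~ [exists b : 'F_p, a == b ^+ 2]].

Definition transp (X : finType) (A : {set X * X}) : {set X * X} :=
  [set xy | (xy.2, xy.1) \in A].

Definition association_scheme (X : finType) (d : nat)
    (A : 'I_d.+1 -> {set X * X}) : Prop :=
  [/\ (0 < #|X|)%N,
      injective A /\ partition [set A i | i : 'I_d.+1] [set: X * X],
      A ord0 = [set xy | xy.1 == xy.2],
      forall j, exists j', transp (A j) = A j' &
      forall u v w, exists k : nat, forall x y, (x, y) \in A w ->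
        #|[set z | ((x, z) \in A u) && ((z, y) \in A v)]| = k].

Definition symmetric_association_scheme (X : finType) (d : nat)
    (A : 'I_d.+1 -> {set X * X}) : Prop :=
  association_scheme A /\ forall j, transp (A j) = A j.

(* The unordered partition U is enumerated, without repetition, as
   U_0 = {0}, U_1, ..., U_d. *)
Definition induces_symmetric_scheme (p n d : nat)
    (U : {set {set 'rV['F_p]_n}}) : Prop :=
  exists u : 'I_d.+1 -> {set 'rV['F_p]_n},
    [/\ injective u,
        U = [set u i | i : 'I_d.+1],
        u ord0 = [set 0] &
        symmetric_association_scheme
          (fun i => [set ab : 'rV['F_p]_n * 'rV['F_p]_n |
                      ab.1 - ab.2 \in u i])].

Definition U10 (R : realType) (p n : nat) (f : 'rV['F_p]_n -> 'F_p) :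
    {set {set 'rV['F_p]_n}} :=
  [set [set 0]; cset R f 0 :\ 0]
    :|: [set cset R f j | j in squares p]
    :|: [set dset R f j | j : 'F_p].

Definition U11 (R : realType) (p n : nat) (f : 'rV['F_p]_n -> 'F_p) :
    {set {set 'rV['F_p]_n}} :=
  [set [set 0]; cset R f 0 :\ 0]
    :|: [set cset R f j | j in nonsquares p]
    :|: [set dset R f j | j : 'F_p].

Definition U12 (R : realType) (p n : nat) (f : 'rV['F_p]_n -> 'F_p) :
    {set {set 'rV['F_p]_n}} :=
  [set [set 0]; orthc (Bplus R f) :\ 0; cset R f 0 :\: orthc (Bplus R f)]
    :|: [set cset R f j | j in [set~ (0 : 'F_p)]]
    :|: [set dset R f j | j : 'F_p].

Definition U13 (R : realType) (p n : nat) (f : 'rV['F_p]_n -> 'F_p) :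
    {set {set 'rV['F_p]_n}} :=
  [set [set 0]; orthc (Bminus R f) :\ 0; cset R f 0 :\: orthc (Bminus R f)]
    :|: [set cset R f j | j in [set~ (0 : 'F_p)]]
    :|: [set dset R f j | j : 'F_p].

(* Main.v *)
(* Let A = B_+(f^* ), and let B be B_+(f) if p = 1 mod 4 and B_-(f) if
   p = 3 mod 4. Adding the Fourier inversion formula for f to the Walsh transform
   of f^*, and reading the result modulo 2 in Z[xi], gives f^**(-x) = f(x) and
     sum_(a in B) xi^(f^*(a) + a.x) = mu p^(n/2) xi^(f(x)) if x is in A, else 0,
   together with similar formulas for the complements and for the sums over A.
   Galois conjugation scales the exponents by any c <> 0, and f^* is homogeneous
   because f is and gcd(h-1, p-1) = 1. Hence the character sums over the sets {0},
   B^\bot \ {0}, and the level sets of f on the rest of A and outside A depend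
   only on the class of the character in the partition built in the same way
   from (A, f^* ), and conversely. So the Fourier transform exchanges the spans of
   the indicator functions of the two partitions; being closed under pointwise
   products, each span is closed under convolution, which gives the scheme.
   The case a = 0 of the formulas gives the cardinals of the classes. The sign of
   the quadratic Gauss sum decides whether squares or nonsquares occur when
   r = (n+1)/2.
   The values of the Walsh transform of a bent function are found by multiplying
   by the Gauss sum and comparing (1 - xi)-adic valuations: this leaves an element
   of Z[xi] of absolute value 1, and such an element is a root of unity up to
   sign. *)

Require Import Defs.
From mathcomp Require Import all_boot all_order all_algebra.
From mathcomp Require Import all_reals all_analysis.
From mathcomp Require Import complex.
From mathcomp Require Import finfield.
From mathcomp Require Import ring zify.

Import Order.TTheory GRing.Theory Num.Theory.

Local Open Scope ring_scope.

Section CyclotomicIntegers.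

Set Implicit Arguments.
Unset Strict Implicit.

Variables (p : nat) (p_prime : prime p) (p_odd : odd p).

Local Notation m := p./2.

(** * The quadratic character *)

Lemma p_halfE : p = m.*2.+1.
Proof. by rewrite -[LHS]odd_double_half p_odd. Qed.

Lemma half_gt0 : (0 < m)%N.
Proof. have := prime_gt1 p_prime; have := p_halfE; lia. Qed.

Lemma p_gt2 : (2 < p)%N.
Proof. have := half_gt0; have := p_halfE; lia. Qed.

Lemma Fp_fermat (j : 'F_p) : j != 0 -> j ^+ p.-1 = 1.
Proof.
move=> j0; apply: (mulfI j0); rewrite -exprS (ltn_predK (prime_gt0 p_prime)) mulr1.
by rewrite -[X in _ ^+ X](card_Fp p_prime) expf_card.
Qed.

Lemma Fp_half_sign (j : 'F_p) : j != 0 -> (j ^+ m == 1) || (j ^+ m == -1).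
Proof.
move=> j0; rewrite -sqrf_eq1 -exprM muln2 -(Fp_fermat j0).
by rewrite [in p.-1]p_halfE.
Qed.

Lemma Fp_one_neqN1 : 1 != -1 :> 'F_p.
Proof.
rewrite -subr_eq0 opprK -[1 + 1]/(2%:R) -(dvdn_pcharf (pchar_Fp p_prime)).
by rewrite gtnNdvd // p_gt2.
Qed.

Lemma Fp_N1_neq1 : (-1 == 1 :> 'F_p) = false.
Proof. by rewrite eq_sym (negPf Fp_one_neqN1). Qed.

(** The Legendre symbol, defined by Euler's criterion; integer values let it serve as a coefficient
    both in [C] and in ['F_p]. *)
Definition eta (j : 'F_p) : int :=
  if j == 0 then 0 else if j ^+ m == 1 then 1 else -1.

Lemma eta0 : eta 0 = 0. Proof. by rewrite /eta eqxx. Qed.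

Lemma eta_euler j : (eta j)%:~R = j ^+ m.
Proof.
rewrite /eta; case: eqVneq => [->|j0]; first by rewrite expr0n eqn0Ngt half_gt0.
by have /orP[/eqP ->|/eqP ->] := Fp_half_sign j0; rewrite ?eqxx ?Fp_N1_neq1.
Qed.

Lemma eta_sign j : j != 0 -> eta j = 1 \/ eta j = -1.
Proof. by move=> j0; rewrite /eta (negPf j0); case: ifP; [left|right]. Qed.

Lemma etaM i j : eta (i * j) = eta i * eta j.
Proof.
rewrite /eta mulf_eq0; case: eqVneq => [_|i0]; first by rewrite mul0r.
case: eqVneq => [_|j0] /=; first by rewrite mulr0.
have /orP[/eqP Ei|/eqP Ei] := Fp_half_sign i0;
  have /orP[/eqP Ej|/eqP Ej] := Fp_half_sign j0;
  by rewrite exprMn Ei Ej ?mulrNN ?mulr1 ?mul1r ?eqxx ?Fp_N1_neq1 ?eqxx.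
Qed.

Lemma etaMM j : j != 0 -> eta j * eta j = 1.
Proof. by move/eta_sign => [] ->. Qed.

Lemma eta1 : eta 1 = 1.
Proof. by rewrite /eta oner_eq0 expr1n eqxx. Qed.

Lemma etaN1 : eta (-1) = (-1) ^+ m.
Proof.
rewrite /eta oppr_eq0 oner_eq0 -[in LHS]signr_odd -[in RHS]signr_odd.
by case: (odd m); rewrite ?expr0 ?expr1 ?eqxx ?Fp_N1_neq1.
Qed.

(** X^k - 1 has at most k roots, fewer than the p - 1 units. *)
Lemma exists_Fp_pow_neq1 k : (0 < k < p.-1)%N -> exists2 a : 'F_p, a != 0 & a ^+ k != 1.
Proof.
case/andP=> k0 kp; apply/exists_inP; apply: contraTT kp.
rewrite negb_exists_in => /forall_inP a1; rewrite -leqNgt.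
pose s := enum [set~ (0 : 'F_p)].
have := @max_poly_roots _ ('X^k - 1%:P : {poly 'F_p}) s.
rewrite size_XnsubC // -cardE cardsC1 card_Fp // => H.
apply: H; first by rewrite -size_poly_gt0 size_XnsubC.
  apply/allP => a; rewrite mem_enum !inE => /a1/negPn/eqP ak.
  by rewrite /root hornerD hornerN hornerC hornerXn ak subrr.
exact: enum_uniq.
Qed.

(** Replacing j by a * j multiplies the sum by a^k, and some unit a has a^k different from 1. *)
Lemma sum_Fp_pow k : (0 < k < p.-1)%N -> \sum_(j : 'F_p) j ^+ k = 0.
Proof.
move=> /exists_Fp_pow_neq1[a a0 ak]; apply/eqP.
suff: (a ^+ k - 1) * \sum_(j : 'F_p) j ^+ k == 0 by rewrite mulf_eq0 subr_eq0 (negPf ak).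
rewrite mulrBl mul1r mulr_sumr subr_eq0; apply/eqP.
rewrite [RHS](@reindex_inj _ _ _ 'F_p (fun j => a * j) _ _ (mulfI a0)).
by apply: eq_bigr => j _; rewrite exprMn.
Qed.

Lemma sum_Fp_pow_pred : \sum_(j : 'F_p) j ^+ p.-1 = -1.
Proof.
have p1 : (0 < p.-1)%N by have := p_gt2; lia.
rewrite (bigD1 0) //= expr0n eqn0Ngt p1 add0r (eq_bigr (fun=> 1)) => [|j /Fp_fermat //].
rewrite sumr_const (eq_card (B := predC1 0)) // cardC1 card_Fp //.
rewrite -subn1 natrB ?prime_gt0 // pchar_Fp_0 // sub0r //.
Qed.

(** Scaling the variable by a nonsquare [a] negates the sum. *)
Lemma sum_eta : \sum_(j : 'F_p) eta j = 0.
Proof.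
have [|a a0 am] := @exists_Fp_pow_neq1 m.
  by have := half_gt0; have := p_halfE; lia.
have ea : eta a = -1 by rewrite /eta (negPf a0) (negPf am).
have : \sum_(j : 'F_p) eta j = - \sum_(j : 'F_p) eta j.
  rewrite -mulN1r -ea mulr_sumr [LHS](@reindex_inj _ _ _ 'F_p (fun j => a * j) _ _ (mulfI a0)).
  by apply: eq_bigr => j _; rewrite etaM.
by move: (\sum_(j : 'F_p) _) => S; lia.
Qed.

Lemma card_eta_sign : #|[set j | eta j == 1]| = m /\ #|[set j | eta j == -1]| = m.
Proof.
set X := [set j | eta j == 1]; set Y := [set j | eta j == -1].
have E1 : (#|X|%:R - #|Y|%:R = 0 :> int).
  transitivity (\sum_(j : 'F_p) eta j); last exact: sum_eta.
  rewrite -!sum1_card !natr_sum big_mkcond [X in _ - X]big_mkcond -sumrB /=.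
  apply: eq_bigr => j _; rewrite !inE; by have [->|/eta_sign[] ->] := eqVneq j 0; rewrite ?eta0.
have E2 : (#|X| + #|Y| = p.-1)%N.
  have <- : #|[set~ (0 : 'F_p)]| = p.-1 by rewrite cardsC1 card_Fp.
  rewrite -cardsUI.
  have -> : X :&: Y = set0.
    by apply/setP => j; rewrite !inE; apply/negP => /andP[/eqP -> ].
  rewrite cards0 addn0; apply: eq_card => j; rewrite !inE.
  by have [->|j0] := eqVneq j 0; [rewrite eta0 | case: (eta_sign j0) => ->].
have := p_halfE; lia.
Qed.

(** One inclusion is multiplicativity. The other is a count: squaring is at most two-to-one on the
    2m units, so there are at least m squares. *)
Lemma squaresE : squares p = [set j | eta j == 1].
Proof.
apply/eqP; rewrite eqEcard; apply/andP; split.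
  apply/subsetP => j; rewrite !inE => /andP[j0 /existsP[b /eqP jE]].
  by rewrite jE expr2 etaM etaMM //; apply: contraNneq j0 => b0; rewrite jE b0 expr0n.
have cF : #|[set~ (0 : 'F_p)]| = m.*2 by rewrite cardsC1 card_Fp // [in LHS]p_halfE.
rewrite (card_eta_sign).1 -leq_double -cF.
rewrite -[#|[set~ _]|]sum1_card (partition_big (fun b => b ^+ 2) (mem (squares p))) /=; last first.
  by move=> b; rewrite !inE => b0; rewrite expf_neq0 //; apply/existsP; exists b.
rewrite -muln2 -sum_nat_const; apply: leq_sum => s; rewrite inE => /andP[_ /existsP[b /eqP ->]].
rewrite sum1_card; apply: leq_trans (_ : #|[set b; - b]| <= 2)%N; last by rewrite cards2; case: eqP.
apply: subset_leq_card; apply/subsetP => c; rewrite !inE => /andP[_ /eqP/eqP].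
by rewrite eqf_sqr.
Qed.

Lemma nonsquaresE : nonsquares p = [set j | eta j == -1].
Proof.
apply/setP => j; have /setP/(_ j) := squaresE; rewrite !inE.
have [->|j0] := eqVneq j 0; first by rewrite eta0.
by rewrite !andTb => ->; case: (eta_sign j0) => ->.
Qed.

Variables (C : numClosedFieldType) (z : C) (z_prim : p.-primitive_root z).

(** * The ring Z[z] of cyclotomic integers *)

(** The additive character of ['F_p]: the exponent is the representative in [0, p-1], and
    [z ^+ p = 1] turns sums into products. *)
Definition echar (j : 'F_p) : C := z ^+ j.

Local Notation e := echar.

Lemma z_exp_p : z ^+ p = 1. Proof. exact: prim_expr_order. Qed.

Lemma echar_nat n : e n%:R = z ^+ n.
Proof. by rewrite /e val_Fp_nat // expr_mod // z_exp_p. Qed.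

Lemma echar0 : e 0 = 1. Proof. by rewrite /e expr0. Qed.

Lemma echarD (i j : 'F_p) : e (i + j) = e i * e j.
Proof. by rewrite -[in LHS](natr_Zp i) -[in LHS](natr_Zp j) -natrD echar_nat exprD. Qed.

Lemma echarM (c j : 'F_p) : e (c * j) = e c ^+ j.
Proof. by rewrite -[in LHS](natr_Zp c) -[in LHS](natr_Zp j) -natrM echar_nat exprM. Qed.

Lemma echarX (c : 'F_p) n : e c ^+ n = e (n%:R * c).
Proof. by rewrite -[in RHS](natr_Zp c) -natrM echar_nat mulnC exprM. Qed.

Lemma echar_neq0 j : e j != 0.
Proof.
apply/eqP => ej0; have : e (j - j) = 0 by rewrite echarD ej0 mul0r.
by rewrite subrr echar0 => /eqP; rewrite oner_eq0.
Qed.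

Lemma echarN (j : 'F_p) : e (- j) = (e j)^-1.
Proof.
by apply: (mulfI (echar_neq0 j)); rewrite -echarD subrr echar0 mulfV // echar_neq0.
Qed.

Lemma ord_lt_p (j : 'F_p) : (j < p)%N.
Proof. by rewrite -[X in (_ < X)%N](Fp_cast p_prime) ltn_ord. Qed.

Lemma echar_inj : injective e.
Proof.
move=> i j /eqP; rewrite /e (eq_prim_root_expr z_prim) => /eqP.
by rewrite !modn_small ?ord_lt_p // => /val_inj.
Qed.

Lemma sum_Fp_nat (V : nmodType) (F : 'F_p -> V) :
  \sum_(j : 'F_p) F j = \sum_(0 <= i < p) F i%:R.
Proof.
rewrite -[X in index_iota _ X](Fp_cast p_prime) big_mkord.
by apply: eq_bigr => j _; rewrite natr_Zp.
Qed.

Lemma sum_echar_mul (c : 'F_p) : \sum_(j : 'F_p) e (c * j) = if c == 0 then p%:R else 0.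
Proof.
case: eqVneq => [->|c0].
  under eq_bigr do rewrite mul0r echar0.
  by rewrite sumr_const card_Fp.
have ec1 : e c != 1 by rewrite -echar0 (inj_eq echar_inj).
apply: (mulIf (x := e c - 1)); first by rewrite subr_eq0.
rewrite mul0r mulrBr mulr1; apply/eqP; rewrite subr_eq0; apply/eqP.
rewrite mulr_suml [RHS](@reindex_inj _ _ _ 'F_p (fun j => j + 1) _ _ (addIr 1)).
by apply: eq_bigr => j _; rewrite mulrDr mulr1 echarD.
Qed.

Lemma sum_echar : \sum_(j : 'F_p) e j = 0.
Proof.
have := sum_echar_mul 1; rewrite oner_eq0; under eq_bigr do rewrite mul1r.
by [].
Qed.

(* ((1 + X)^p - 1) / X, the p-th cyclotomic polynomial in X + 1, to which
   Eisenstein's criterion applies. *)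
Definition shifted_Phi : {poly int} := \poly_(k < p) ('C(p, k.+1))%:Z.

Lemma size_shifted_Phi : size shifted_Phi = p.
Proof.
have p0 := prime_gt0 p_prime.
by rewrite size_poly_eq // (ltn_predK p0) binn.
Qed.

Lemma shifted_Phi_irreducible : irreducible_poly shifted_Phi.
Proof.
have p0 := prime_gt0 p_prime; have p1 := prime_gt1 p_prime.
apply: (@eisenstein_crit p) => //.
- by rewrite size_shifted_Phi neq_ltn p1 orbT.
- rewrite lead_coefE size_shifted_Phi coef_poly (ltn_predK p0) leqnn binn.
  by rewrite dvdzE /= dvdn1 neq_ltn p1 orbT.
- rewrite coef_poly p0 bin1 dvdzE /= gtnNdvd //.
  by rewrite -[X in (_ < X)%N]/(p * p)%N -{1}[p]muln1 ltn_pmul2l.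
move=> i; rewrite size_shifted_Phi => i_lt.
have ip : (i < p)%N by lia.
rewrite coef_poly ip dvdzE /=; apply: prime_dvd_bin => //; lia.
Qed.

Lemma shifted_Phi_root : root (map_poly intr shifted_Phi) (z - 1).
Proof.
have z1 : z - 1 != 0.
  rewrite subr_eq0 -(expr1 z) -(prim_order_dvd z_prim) gtnNdvd //.
  exact: prime_gt1.
apply/eqP/(mulIf z1); rewrite mul0r.
have -> : map_poly intr shifted_Phi = \poly_(k < p) ('C(p, k.+1))%:R :> {poly C}.
  by apply/polyP => i; rewrite coef_map !coef_poly; case: ifP.
rewrite horner_poly mulr_suml.
have : (1 + (z - 1)) ^+ p - 1 = 0 by rewrite [1 + _]addrC subrK z_exp_p subrr.
rewrite exprDn big_ord_recl /= bin0 mulr1n subn0 expr1n expr0 mulr1.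
rewrite addrC addKr => {2}<-; apply: eq_bigr => i _.
by rewrite expr1n mul1r /bump /= add1n -mulrA -exprSr mulr_natl.
Qed.

(** [q], irreducible of size p, is up to a constant the minimal polynomial of [z - 1]: the common
    root excludes a trivial gcd, so [q] divides [r], which is too short unless it is zero. *)
Lemma shifted_poly_eq0 (r : {poly rat}) :
  (size r < p)%N -> root (map_poly ratr r) (z - 1) -> r = 0.
Proof.
move=> szr rz; apply/eqP; apply: contraTT szr => r0; rewrite -leqNgt.
pose q : {poly rat} := map_poly intr shifted_Phi.
have qirr : irreducible_poly q.
  by apply/irreducible_rat_int; exact: shifted_Phi_irreducible.
have szq : size q = p.
  by rewrite size_map_inj_poly ?size_shifted_Phi //; exact: intr_inj.
have qz : root (map_poly ratr q) (z - 1).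
  rewrite /q -map_poly_comp; suff -> : map_poly (ratr \o intr) shifted_Phi =
    map_poly intr shifted_Phi :> {poly C} by exact: shifted_Phi_root.
  by apply: eq_map_poly => x /=; rewrite ratr_int.
have [g1|gq] := irredp_XsubCP qirr (dvdp_gcdl q r).
  have : coprimep (map_poly (ratr : rat -> C) q) (map_poly ratr r).
    by rewrite coprimep_map -gcdp_eqp1.
  by move/coprimep_root/(_ qz); move: rz; rewrite /root => ->.
rewrite -szq -(eqp_size gq); apply: dvdp_leq => //; exact: dvdp_gcdr.
Qed.

(** Subtracting a multiple of the relation [sum_echar] kills the coefficient of z^(p-1) = e(-1). A
    polynomial of degree at most p - 2 vanishing at z remains, and it is zero after the shift by
    1. *)
Lemma echar_lin_indep (c : 'F_p -> int) :
  \sum_(j : 'F_p) (c j)%:~R * e j = 0 -> forall i j, c i = c j.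
Proof.
move=> c0; suff cN i : c i = c (- 1) by move=> i j; rewrite !cN.
pose d j := c j - c (- 1).
have p0 := prime_gt0 p_prime; have p1 := prime_gt1 p_prime.
have pE : (p.-1).+1 = p by rewrite (ltn_predK p0).
have last : (p.-1)%:R = -1 :> 'F_p.
  by apply/eqP; rewrite -addr_eq0 -[1]/(1%:R) -natrD addn1 pE pchar_Fp_0.
pose r : {poly rat} := \poly_(i < p.-1) (d i%:R)%:~R.
have rz : (map_poly ratr r).[z] = 0 :> C.
  transitivity (\sum_(j : 'F_p) (d j)%:~R * e j); last first.
    rewrite -[RHS]c0 /d; apply/eqP; rewrite -subr_eq0 -sumrB; apply/eqP.
    transitivity (\sum_(j : 'F_p) (- (c (-1))%:~R) * e j).
      by apply: eq_bigr => j _; rewrite -mulrBl rmorphB /= addrC addKr.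
    by rewrite -mulr_sumr sum_echar mulr0.
  rewrite sum_Fp_nat -[X in index_iota _ X]pE big_nat_recr //= last /d subrr mul0r addr0 big_mkord.
  have -> : map_poly ratr r = \poly_(i < p.-1) (d i%:R)%:~R :> {poly C}.
    apply/polyP => k; rewrite coef_map !coef_poly /=.
    by case: ifP; rewrite ?rmorph0 ?ratr_int.
  by rewrite horner_poly; apply: eq_bigr => k _; rewrite echar_nat.
have r0 : r \Po ('X + 1%:P) = 0.
  apply: shifted_poly_eq0.
    rewrite size_comp_poly2 ?size_XaddC //.
    by apply: leq_ltn_trans (size_poly _ _) _; rewrite pE.
  by rewrite /root map_comp_poly horner_comp rmorphD /= map_polyX map_polyC /=
             !hornerE rmorph1 subrK rz.
have {}r0 : r = 0 by apply/eqP; rewrite -(comp_poly2_eq0 r (size_XaddC 1)) r0.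
apply/eqP; rewrite -subr_eq0 -/(d i); move: (ord_lt_p i).
rewrite -ltnS ltnS -[X in (_ < X)%N]pE ltnS leq_eqVlt => /orP[/eqP iE|ilt].
  by rewrite /d -(natr_Zp i) iE last subrr.
have := congr1 (fun q : {poly rat} => q`_i) r0.
by rewrite coef_poly ilt coef0 natr_Zp => /eqP; rewrite intr_eq0.
Qed.

(** * Galois conjugation and residues modulo [1 - z] *)

Definition cyc (c : 'F_p -> int) : C := \sum_(j : 'F_p) (c j)%:~R * e j.

Lemma sum_int_echar (I : finType) (P : pred I) (a : I -> int) (phi : I -> 'F_p) :
  \sum_(i | P i) (a i)%:~R * e (phi i) =
  cyc (fun j => \sum_(i | P i && (phi i == j)) a i).
Proof.
rewrite (partition_big phi predT) //=; apply: eq_bigr => j _.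
rewrite rmorph_sum mulr_suml; apply: eq_bigr => i /andP[_ /eqP ->] //.
Qed.

(** The automorphism z -> z^t, stated as its effect on integer relations. Grouped by exponent, a
    relation has constant coefficients, so permuting the exponents preserves it. *)
Lemma galois_echar (I : finType) (P : pred I) (a : I -> int) (phi : I -> 'F_p) t :
  t != 0 -> \sum_(i | P i) (a i)%:~R * e (phi i) = 0 ->
  \sum_(i | P i) (a i)%:~R * e (t * phi i) = 0.
Proof.
move=> t0; rewrite sum_int_echar => /echar_lin_indep cst.
rewrite (partition_big phi predT) //=.
transitivity (\sum_(j : 'F_p) (\sum_(i | P i && (phi i == 0)) a i)%:~R * e (t * j)).
  apply: eq_bigr => j _; rewrite (cst 0 j) rmorph_sum mulr_suml.
  by apply: eq_bigr => i /andP[_ /eqP ->].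
by rewrite -mulr_sumr sum_echar_mul (negPf t0) mulr0.
Qed.

(* [residue x m] : x lies in Z[z] and is sent to m by the ring morphism
   Z[z] -> F_p with z |-> 1, whose kernel is generated by 1 - z. *)
Definition residue (x : C) (m : 'F_p) :=
  exists2 c, x = cyc c & (\sum_(j : 'F_p) c j)%:~R = m.

(** Two coefficient families of one element differ by a constant, which changes their sum by a
    multiple of p. *)
Lemma residue_uniq x m m' : residue x m -> residue x m' -> m = m'.
Proof.
move=> [c -> <-] [c' E <-].
have : cyc (fun j => c j - c' j) = 0.
  rewrite -(subrr (cyc c')) -{1}E /cyc -sumrB.
  by apply: eq_bigr => j _; rewrite rmorphB mulrBl.
move/echar_lin_indep => cst; apply/eqP; rewrite -subr_eq0 -rmorphB -sumrB /=.
rewrite (eq_bigr (fun=> c 0 - c' 0)); last by move=> j _; exact: cst.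
by rewrite sumr_const card_Fp // -mulr_natr rmorphM /= rmorph_nat pchar_Fp_0 ?mulr0.
Qed.

Lemma residue_sum_int (I : finType) (P : pred I) (a : I -> int) (phi : I -> 'F_p) :
  residue (\sum_(i | P i) (a i)%:~R * e (phi i)) (\sum_(i | P i) a i)%:~R.
Proof.
exists (fun j => \sum_(i | P i && (phi i == j)) a i); first exact: sum_int_echar.
by rewrite [in RHS](partition_big phi predT).
Qed.

Lemma residue_int (k : int) : residue k%:~R k%:~R.
Proof.
have := residue_sum_int xpredT (fun _ : 'I_1 => k) (fun=> 0).
by rewrite !big_ord1 echar0 mulr1.
Qed.

Lemma residue_echar j : residue (e j) 1.
Proof.
have := residue_sum_int xpredT (fun _ : 'I_1 => 1) (fun=> j).
by rewrite !big_ord1 mul1r.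
Qed.

Lemma residueD x y m m' : residue x m -> residue y m' -> residue (x + y) (m + m').
Proof.
move=> [c -> <-] [c' -> <-]; exists (fun j => c j + c' j).
  by rewrite -big_split; apply: eq_bigr => j _ /=; rewrite rmorphD mulrDl.
by rewrite -rmorphD -big_split.
Qed.

Lemma residueM x y m m' : residue x m -> residue y m' -> residue (x * y) (m * m').
Proof.
move=> [c -> <-] [c' -> <-].
have := residue_sum_int xpredT (fun u : 'F_p * 'F_p => c u.1 * c' u.2)
  (fun u : 'F_p * 'F_p => u.1 + u.2).
rewrite -(pair_bigA _ (fun i j => c i * c' j)) /= -[in X in _ -> X]rmorphM /=.
rewrite -(pair_bigA _ (fun i j => (c i * c' j)%:~R * e (i + j))) /=.
rewrite !big_distrlr /=; congr residue; apply: eq_bigr => i _; apply: eq_bigr => j _.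
by rewrite echarD rmorphM /=; ring.
Qed.

Lemma residueN x m : residue x m -> residue (- x) (- m).
Proof. by move=> /(residueM (residue_int (-1))); rewrite !rmorphN /= !mulN1r. Qed.

Lemma residueB x y m m' : residue x m -> residue y m' -> residue (x - y) (m - m').
Proof. by move=> xm /residueN; exact: residueD. Qed.

Lemma residue_nat n : residue n%:R n%:R.
Proof. by have := residue_int n; rewrite !pmulrn. Qed.

Lemma residueX x m n : residue x m -> residue (x ^+ n) (m ^+ n).
Proof.
move=> xm; elim: n => [|n IHn]; first by rewrite !expr0; exact: (residue_nat 1).
by rewrite !exprS; exact: residueM.
Qed.

Lemma residue_sum (I : Type) (r : seq I) (P : pred I) (F : I -> C) (G : I -> 'F_p) :
  (forall i, P i -> residue (F i) (G i)) ->
  residue (\sum_(i <- r | P i) F i) (\sum_(i <- r | P i) G i).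
Proof.
move=> FG; apply: (big_ind2 residue) => //; first exact: (residue_nat 0).
by move=> *; exact: residueD.
Qed.

Lemma residue_prod (I : Type) (r : seq I) (P : pred I) (F : I -> C) (G : I -> 'F_p) :
  (forall i, P i -> residue (F i) (G i)) ->
  residue (\prod_(i <- r | P i) F i) (\prod_(i <- r | P i) G i).
Proof.
move=> FG; apply: (big_ind2 residue) => //; first exact: (residue_nat 1).
by move=> *; exact: residueM.
Qed.

(** * Complex conjugation and divisibility by [1 - z] *)

Lemma echar_conj j : (e j)^* = e (- j).
Proof.
rewrite echarN; apply: (mulfI (echar_neq0 j)); rewrite mulfV ?echar_neq0 //.
rewrite -normCK; suff -> : `|e j| = 1 by rewrite expr1n.
apply/eqP; rewrite -(@pexpr_eq1 _ _ p) ?prime_gt0 ?normr_ge0 //.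
by rewrite -normrX echarX pchar_Fp_0 ?mul0r ?echar0 ?normr1.
Qed.

Lemma residue_conj x m : residue x m -> residue x^* m.
Proof.
move=> [c -> <-]; exists (fun j => c (- j)).
  rewrite /cyc rmorph_sum /= (@reindex_inj _ _ _ 'F_p -%R _ _ oppr_inj) /=.
  by apply: eq_bigr => j _; rewrite rmorphM /= echar_conj opprK rmorph_int.
by rewrite [in RHS](@reindex_inj _ _ _ 'F_p -%R _ _ oppr_inj).
Qed.

Lemma z_echar1 : z = e 1. Proof. by rewrite -[1]/(1%:R) echar_nat. Qed.

(** p is the sum of all [1 - e j], and each term is a multiple of [1 - z] by the geometric sum. *)
Lemma residue_p_dvd : exists2 y, p%:R = (1 - z) * y & exists m, residue y m.
Proof.
have : p%:R = \sum_(j : 'F_p) (1 - e j) by rewrite sumrB sum_echar subr0 sumr_const card_Fp.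
have [y yE ym] : {y : 'F_p -> C | forall j, 1 - e j = (1 - z) * y j
                  & forall j, residue (y j) j}.
  exists (fun j : 'F_p => \sum_(i < j) z ^+ i) => j.
    by rewrite -opprB subrX1 -mulNr opprB.
  rewrite -[X in residue _ X]natr_Zp -[X in X%:R](card_ord j) -sumr_const.
  by apply: residue_sum => i _; rewrite -echar_nat; exact: residue_echar.
under eq_bigr do rewrite yE; rewrite -mulr_sumr => pE.
exists (\sum_(j : 'F_p) y j) => //; exists (\sum_(j : 'F_p) j).
by apply: residue_sum => j _.
Qed.

(** Modulo [1 - z] every [e j] is 1, so x is congruent to the sum of its coefficients; that sum is a
    multiple of p, hence of [1 - z]. *)
Lemma residue0_dvd x : residue x 0 -> exists2 y, x = (1 - z) * y & exists m, residue y m.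
Proof.
move=> [c -> c0].
have [k kE] : exists k : int, \sum_(j : 'F_p) c j = k * p%:Z.
  apply/dvdzP; by rewrite (dvdz_pcharf (pchar_Fp p_prime)) c0.
have [y yE [m ym]] := residue_p_dvd.
pose s (j : 'F_p) := \sum_(i < j) z ^+ i.
have sE j : 1 - e j = (1 - z) * s j by rewrite -opprB subrX1 -mulNr opprB.
exists (k%:~R * y - \sum_(j : 'F_p) (c j)%:~R * s j).
  rewrite mulrBr mulrCA -yE mulr_sumr -[p%:R]/(p%:~R) -rmorphM /= -kE rmorph_sum -sumrB.
  by apply: eq_bigr => j _; rewrite mulrCA -sE; ring.
exists (k%:~R * m - \sum_(j : 'F_p) (c j)%:~R * \sum_(i < j) 1).
apply: residueB; first by apply: residueM => //; exact: residue_int.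
apply: residue_sum => j _; apply: residueM; first exact: residue_int.
by apply: residue_sum => i _; rewrite -echar_nat; exact: residue_echar.
Qed.

Lemma one_sub_z_neq0 : 1 - z != 0.
Proof. by rewrite subr_eq0 z_echar1 -echar0 (inj_eq echar_inj) eq_sym oner_eq0. Qed.

Lemma residue_one_sub_z : residue (1 - z) 0.
Proof.
rewrite -(subrr 1) z_echar1; apply: residueB; last exact: residue_echar.
exact: (residue_nat 1).
Qed.

(** The factorization of (X^p - 1) / (X - 1), evaluated at 1. *)
Lemma prod_one_sub_z : \prod_(1 <= k < p) (1 - z ^+ k) = p%:R.
Proof.
have := factor_Xn_sub_1 z_prim; rewrite subrX1 big_ltn ?prime_gt0 // expr0 => /mulfI.
move=> /(_ (negbT (polyXsubC_eq0 1))) /(congr1 (fun q : {poly C} => q.[1])).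
rewrite horner_prod horner_sum => E.
transitivity (\sum_(i < p) ('X^i : {poly C}).[1]).
  by rewrite -E; apply: eq_bigr => i _; rewrite hornerXsubC.
under eq_bigr do rewrite hornerXn expr1n.
by rewrite sumr_const card_ord.
Qed.

(** z is the power of z^k with exponent the inverse of k modulo p, so [1 - z ^+ k] divides [1 - z];
    the product over k is p. *)
Lemma p_dvd_one_sub_z_exp :
  exists2 y, (1 - z) ^+ p.-1 = p%:R * y & exists m, residue y m.
Proof.
pose t k : C := \sum_(i < ((k%:R : 'F_p)^-1 : 'F_p)) (z ^+ k) ^+ i.
have tE k : (1 <= k < p)%N -> 1 - z = (1 - z ^+ k) * t k.
  case/andP=> k0 kp; rewrite -opprB -[in RHS]opprB mulNr -subrX1 -echar_nat -echarM mulfV.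
    by rewrite -z_echar1.
  by rewrite -(dvdn_pcharf (pchar_Fp p_prime)) gtnNdvd.
exists (\prod_(1 <= k < p) t k).
  rewrite -prod_one_sub_z -big_split /= -[p.-1]subn1 -prodr_const_nat.
  by rewrite big_nat [RHS]big_nat; apply: eq_bigr => k /tE.
exists (\prod_(1 <= k < p) \sum_(i < ((k%:R : 'F_p)^-1 : 'F_p)) 1).
apply: residue_prod => k _; apply: residue_sum => i _.
by rewrite -exprM -echar_nat; exact: residue_echar.
Qed.

Lemma one_sub_z_exp_dvd_p :
  exists2 y, p%:R = (1 - z) ^+ p.-1 * y & exists m, residue y m.
Proof.
exists (\prod_(1 <= k < p) \sum_(i < k) z ^+ i).
  rewrite -prod_one_sub_z -[p.-1]subn1 -prodr_const_nat -big_split /=.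
  by apply: eq_bigr => k _; rewrite -opprB subrX1 -mulNr opprB.
exists (\prod_(1 <= k < p) \sum_(i < k) 1).
apply: residue_prod => k _; apply: residue_sum => i _.
by rewrite -echar_nat; exact: residue_echar.
Qed.

(* (1 - z)-adic valuation: 1 - z and its conjugate are associated, and p is
   associated to (1 - z)^(p-1). *)
Lemma p_exp_dvd (x : C) (N : nat) :
  (exists m, residue x m) -> x * x^* = p%:R ^+ N.*2 ->
  exists2 y, x = p%:R ^+ N * y & exists m, residue y m.
Proof.
move=> xint xx; set pi := 1 - z.
have [w wE [mw wm]] := one_sub_z_exp_dvd_p; have [w' wE' [mw' wm']] := p_dvd_one_sub_z_exp.
have piC : pi^* = - e (-1) * pi.
  rewrite /pi rmorphB rmorph1 z_echar1 /= echar_conj mulrBr mulr1 mulNr -echarD addNr echar0.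
  by rewrite opprK addrC.
have step k : (k <= N * p.-1)%N -> exists2 y, x = pi ^+ k * y & exists m, residue y m.
  elim: k => [_|k IHk lek]; first by exists x; rewrite ?mul1r.
  have [y yE [m ym]] := IHk (ltnW lek).
  pose d := (N * p.-1 - k.+1)%N.
  have NE : (p.-1 * N.*2 = k.*2 + d.*2.+2)%N by rewrite -doubleMr mulnC /d; lia.
  have E : (- e (-1)) ^+ k * (y * y^*) = pi * (pi ^+ d.*2.+1 * w ^+ N.*2).
    apply: (@mulfI _ (pi ^+ k.*2)); first by rewrite expf_neq0 ?one_sub_z_neq0.
    transitivity (x * x^*).
      by rewrite yE rmorphM rmorphXn /= piC exprMn -addnn exprD; ring.
    by rewrite xx wE exprMn -exprM NE exprD exprS -/pi !mulrA.
  have r0 : residue ((- e (-1)) ^+ k * (y * y^*)) 0.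
    rewrite E -(mul0r (0 ^+ d.*2.+1 * mw ^+ N.*2)).
    apply: residueM; first exact: residue_one_sub_z.
    by apply: residueM; apply: residueX; rewrite ?wm //; exact: residue_one_sub_z.
  have r1 : residue ((- e (-1)) ^+ k * (y * y^*)) ((- 1) ^+ k * (m * m)).
    apply: residueM; first by apply: residueX; apply: residueN; exact: residue_echar.
    by apply: residueM => //; exact: residue_conj.
  have m0 : m = 0.
    have /eqP := residue_uniq r1 r0.
    by rewrite mulf_eq0 signr_eq0 mulf_eq0 orbb => /eqP.
  rewrite m0 in ym; have [y' y'E y'int] := residue0_dvd ym.
  by exists y'; rewrite // exprSr -mulrA -y'E.
have [y yE [m ym]] := step _ (leqnn _).
exists (w' ^+ N * y); first by rewrite yE mulnC exprM wE' exprMn mulrA.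
by exists (mw' ^+ N * m); apply: residueM => //; exact: residueX.
Qed.

(* Choosing the coefficients so that their sum is +-1, the autocorrelations
   must be those of +-e k. *)
Lemma unit_norm1 x : (exists m, residue x m) -> x * x^* = 1 ->
  exists (s : bool) k, x = (-1) ^+ s * e k.
Proof.
move=> [m [c xE cm]] xx.
have m2 : m * m = 1.
  have xm : residue x m by exists c.
  by apply: residue_uniq (residueM xm (residue_conj xm)) _; rewrite xx; exact: residue_nat 1.
have [s sE] : exists s : bool, m = (-1) ^+ s.
  by move/eqP: m2; rewrite -expr2 sqrf_eq1 => /orP[] /eqP ->; [exists false|exists true].
(* The residue fixes the sum of the coefficients modulo p only. Subtracting t from every coefficient
   makes the sum exactly the sign and leaves x unchanged. *)
have [t tE] : exists t : int, \sum_(j : 'F_p) c j - (-1) ^+ s = t * p%:Z.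
  apply/dvdzP; rewrite (dvdz_pcharf (pchar_Fp p_prime)) rmorphB /= cm sE.
  by rewrite rmorph_sign subrr.
pose d j := c j - t.
have d1 : \sum_(j : 'F_p) d j = (-1) ^+ s.
  rewrite sumrB sumr_const card_Fp // -mulr_natr natz -tE; ring.
have {}xE : x = cyc d.
  rewrite xE -[LHS]subr0 -[X in _ - X](mulr0 t%:~R) -sum_echar mulr_sumr -sumrB.
  by apply: eq_bigr => j _; rewrite rmorphB /= mulrBl.
pose R j := \sum_(i : 'F_p) d (i + j) * d i.
have RE : cyc R = 1.
  rewrite -xx xE /cyc rmorph_sum big_distrlr /= exchange_big /=.
  under [RHS]eq_bigr => j _ do rewrite (@reindex_inj _ _ _ 'F_p (fun i => i + j) _ _ (addIr j)) /=.
  rewrite exchange_big /=; apply: eq_bigr => j _; rewrite rmorph_sum mulr_suml.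
  apply: eq_bigr => i _; rewrite rmorphM /= rmorphM /= rmorph_int echar_conj.
  by rewrite [i + j]addrC mulrACA -echarD addrK.
have cst : forall i j, R i - (i == 0)%:R = R j - (j == 0)%:R.
  apply: echar_lin_indep; transitivity (cyc R - 1); last by rewrite RE subrr.
  under eq_bigr do rewrite rmorphB /= mulrBl.
  rewrite sumrB; congr (_ - _); rewrite (bigD1 0) //= echar0 mulr1 big1 ?addr0 //.
  by move=> j /negPf ->; rewrite mul0r.
(* [R] and the coefficients of 1 differ by a constant; both sum to 1, so the constant is zero. As
   [R 0] is a sum of integer squares, one coefficient is a sign and the others vanish. *)
have R0 : R 0 = 1.
  have : \sum_(j : 'F_p) (R j - (j == 0)%:R) = 0.
    have S1 : \sum_(j : 'F_p) (j == 0)%:R = 1 :> int.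
      by rewrite (bigD1 (0 : 'F_p)) //= big1 ?addr0 // => j /negPf ->.
    rewrite sumrB S1 exchange_big /=; apply/eqP; rewrite subr_eq0; apply/eqP.
    transitivity (\sum_(i : 'F_p) (\sum_(j : 'F_p) d j) * d i).
      apply: eq_bigr => i _; rewrite mulr_suml.
      by rewrite [RHS](@reindex_inj _ _ _ 'F_p (fun j => i + j) _ _ (addrI i)).
    by rewrite -mulr_sumr d1 -expr2 sqrr_sign.
  rewrite (eq_bigr (fun=> R 0 - 1)); last by move=> j _; rewrite (cst j 0) eqxx.
  rewrite sumr_const card_Fp // => /eqP; rewrite mulrn_eq0 subr_eq0.
  by rewrite gtn_eqF ?prime_gt0 //= => /eqP.
have [k dk] : exists k, d k != 0.
  apply/existsP; apply: contraT => /existsPn d0; move: R0.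
  rewrite /R big1 // => i _; move/negPn/eqP: (d0 i) => ->; exact: mulr0.
have dk1 : 1 <= d k * d k by rewrite -expr2; nia.
move: R0; rewrite /R (bigD1 k) //= addr0 => R0.
have rest0 : \sum_(i : 'F_p | i != k) d (i + 0) * d i = 0.
  have : 0 <= \sum_(i : 'F_p | i != k) d (i + 0) * d i.
    by apply: sumr_ge0 => i _; rewrite addr0 -expr2 sqr_ge0.
  move: R0 dk1; move: (d k * d k) (\sum_(i | _) _) => q S; lia.
have d0 i : i != k -> d i = 0.
  move=> ik; move/eqP: rest0; rewrite psumr_eq0; last first.
    by move=> j _; rewrite addr0 -expr2 sqr_ge0.
  move/allP/(_ i (mem_index_enum _)); rewrite ik addr0 mulf_eq0 orbb => /eqP //.
have dkE : d k = (-1) ^+ s.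
  by rewrite -d1 (bigD1 k) //= big1 ?addr0 // => i /d0.
exists s, k; rewrite xE /cyc (bigD1 k) //= dkE rmorph_sign big1 ?addr0 //.
by move=> i /d0 ->; rewrite mul0r.
Qed.

(* If a <> b, then modulo 2 the coefficients at a and at any k outside {a, b}
   differ, while the only relation between the e j has constant coefficients. *)
Lemma two_dvd_echar (s t : bool) a b x : (2 < p)%N -> (exists m, residue x m) ->
  (-1) ^+ s * e a + (-1) ^+ t * e b = x *+ 2 -> a = b.
Proof.
move=> p2 [m [c -> _]] E; apply/eqP; apply: contraT => ab.
pose d j : int := (-1) ^+ s * (j == a)%:R + (-1) ^+ t * (j == b)%:R - c j *+ 2.
have delta (k : 'F_p) (u : bool) :
    \sum_(j : 'F_p) ((-1) ^+ u * (j == k)%:R : int)%:~R * e j = (-1) ^+ u * e k.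
  rewrite (bigD1 k) //= big1 ?addr0; first by rewrite eqxx mulr1 rmorph_sign.
  by move=> j /negPf ->; rewrite mulr0 mul0r.
have cst : forall i j, d i = d j.
  apply: echar_lin_indep; rewrite -[RHS](subrr (cyc c *+ 2)) -{1}E /d.
  rewrite -!delta /cyc -big_split -sumrMnl -sumrB; apply: eq_bigr => j _ /=.
  by rewrite rmorphB rmorphD rmorphMn /= mulrBl mulrDl mulrnAl.
have [k ka kb] : exists2 k, k != a & k != b.
  have : (0 < #|~: [set a; b]|)%N.
    by have := cardsC [set a; b]; rewrite cards2 ab card_Fp //; lia.
  by case/card_gt0P => k; rewrite !inE negb_or => /andP[]; exists k.
have := cst a k; rewrite /d eqxx (negPf ab) (negPf ka) (negPf kb) !mulr0 !mulr1 addr0.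
by case: s {E d cst delta}; rewrite ?expr0 ?expr1; lia.
Qed.

(** * The quadratic Gauss sum and its sign *)

Definition gauss : C := \sum_(j : 'F_p) (eta j)%:~R * e j.

Lemma gauss_scale t : t != 0 ->
  \sum_(j : 'F_p) (eta j)%:~R * e (t * j) = (eta t)%:~R * gauss.
Proof.
move=> t0; rewrite /gauss [in RHS](@reindex_inj _ _ _ 'F_p (fun j => t * j) _ _ (mulfI t0)).
rewrite mulr_sumr; apply: eq_bigr => j _.
by rewrite mulrA -rmorphM /= etaM mulrA etaMM // mul1r.
Qed.

Lemma gauss_conj : gauss^* = (-1) ^+ m * gauss.
Proof.
have N10 : (-1 : 'F_p) != 0 by rewrite oppr_eq0 oner_eq0.
rewrite -(rmorph_sign intr) -etaN1 -gauss_scale // /gauss rmorph_sum /=.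
by apply: eq_bigr => j _; rewrite rmorphM /= echar_conj rmorph_int mulN1r.
Qed.

(** Absorb [eta i] into the Gauss sum by scaling and sum over i first: t = 1 contributes p, and the
    common term -1 is killed by [sum_eta]. *)
Lemma gauss_norm : gauss * gauss^* = p%:R.
Proof.
have step (i : 'F_p) : (eta i)%:~R * gauss * e (- i) =
    \sum_(t : 'F_p) (eta t)%:~R * (if i == 0 then 0 else e ((t - 1) * i)).
  case: eqVneq => [->|i0].
    by rewrite eta0 !mul0r big1 // => t _; rewrite mulr0.
  rewrite -gauss_scale // mulr_suml; apply: eq_bigr => t _.
  by rewrite -mulrA -echarD mulrBl mul1r [i * t]mulrC.
have -> : gauss * gauss^* = \sum_(i : 'F_p) (eta i)%:~R * gauss * e (- i).
  rewrite {2}/gauss rmorph_sum mulr_sumr; apply: eq_bigr => i _ /=.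
  by rewrite rmorphM /= rmorph_int echar_conj; ring.
under eq_bigr do rewrite step.
rewrite exchange_big /=.
transitivity (\sum_(t : 'F_p) (eta t)%:~R * ((if t == 1 then p%:R else 0) - 1 : C)).
  apply: eq_bigr => t _; rewrite -mulr_sumr; congr (_ * _).
  have := sum_echar_mul (t - 1); rewrite subr_eq0 => <-.
  rewrite [in RHS](bigD1 (0 : 'F_p)) //= mulr0 echar0 [1 + _]addrC addrK.
  rewrite [LHS](bigD1 (0 : 'F_p)) //= add0r.
  by apply: eq_bigr => i /negPf ->.
under eq_bigr do rewrite mulrBr mulr1.
rewrite sumrB -rmorph_sum sum_eta subr0 (bigD1 (1 : 'F_p)) //= eta1 mul1r big1 ?addr0 //.
by move=> t /negPf ->; rewrite mulr0.
Qed.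

Lemma gauss_sqr : gauss ^+ 2 = (-1) ^+ m * p%:R.
Proof. by rewrite -gauss_norm gauss_conj [gauss * _]mulrCA signrMK expr2. Qed.

Lemma residue_gauss : exists k, residue gauss k.
Proof. by exists (\sum_(j : 'F_p) eta j)%:~R; exists eta. Qed.

Lemma gauss_neq0 : gauss != 0.
Proof.
apply/eqP => g0; have /eqP := gauss_norm.
by rewrite g0 mul0r eq_sym pnatr_eq0 gtn_eqF ?prime_gt0.
Qed.

(* Multiplying by the Gauss sum turns the odd power of sqrt p into a power of p. *)
Lemma sqrt_odd_power x n : (exists k, residue x k) -> odd n -> x * x^* = p%:R ^+ n ->
  exists (s : bool) k, x = (-1) ^+ s * (p%:R ^+ n./2 * gauss) * e k.
Proof.
move=> [k xk] n_odd xx; have [g gk] := residue_gauss.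
have p0 : (p%:R : C) != 0 by rewrite pnatr_eq0 -lt0n prime_gt0.
have xgE : (x * gauss) * (x * gauss)^* = p%:R ^+ (n./2.+1).*2.
  rewrite rmorphM /= mulrACA xx gauss_norm -exprSr -[in n.+1](odd_double_half n) n_odd.
  by rewrite doubleS.
have [|y yE [ky yk]] := p_exp_dvd _ xgE; first by exists (k * g); exact: residueM.
have yy : y * y^* = 1.
  have q0 : (p%:R ^+ (n./2.+1).*2 : C) != 0 by rewrite expf_neq0.
  apply: (mulfI q0); rewrite mulr1 -[in RHS]xgE yE rmorphM rmorphXn /= rmorph_nat.
  by rewrite [RHS]mulrACA -exprD addnn.
have [|s [j yj]] := unit_norm1 _ yy; first by exists ky.
(* The sign [odd m] appears when one factor p is replaced by [(-1) ^+ m * gauss ^+ 2] to cancel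
   [gauss]. *)
exists (s (+) odd m), j; apply: (mulIf gauss_neq0).
rewrite yE yj exprS -[X in X * _ * _ = _](divfK (x := (-1)^+m)) ?signr_eq0 //.
have -> : (p%:R / (-1) ^+ m) * (-1) ^+ m = gauss ^+ 2 * (-1) ^+ m :> C.
  rewrite gauss_sqr divfK ?signr_eq0 // -mulrA [p%:R * _]mulrC mulrA -expr2 sqrr_sign mul1r //.
by rewrite signr_addb signr_odd; ring.
Qed.

(** * The sign of the Gauss sum, by comparison with a product of sines *)

Section GaussSign.

Variables (w : C) (w2 : w ^+ 2 = z) (wp : w ^+ p = -1).

(** For w = exp(i pi / p) the k-th factor is 2 i sin(k pi / p), so the argument of the product is
    known. *)
Definition sine_prod : C := \prod_(1 <= k < m.+1) (w ^+ k - w ^- k).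

Lemma w_neq0 : w != 0.
Proof.
apply/eqP => w0; have := wp; rewrite w0 expr0n gtn_eqF ?prime_gt0 //= => /eqP.
by rewrite eq_sym oppr_eq0 oner_eq0.
Qed.

(** [w ^+ p.+1 = - w] makes [w] minus a power of z; its inverse therefore lies in Z[z], with residue
    -1. *)
Lemma w_inv : w^-1 = - e (- m.+1%:R).
Proof.
apply: (mulfI w_neq0); rewrite mulfV ?w_neq0 // echarN echar_nat -w2 -exprM.
have -> : (2 * m.+1 = p.+1)%N by rewrite [in RHS]p_halfE; lia.
by rewrite exprS wp mulrN1 invrN opprK mulfV ?w_neq0.
Qed.

(** Pair k with p - k in [prod_one_sub_z]: (1 - z^k)(1 - z^-k) = - (w^k - w^-k)^2. *)
Lemma sine_prod_sqr : sine_prod ^+ 2 = (-1) ^+ m * p%:R.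
Proof.
have mp : (m.+1 <= p)%N by rewrite [X in (_ <= X)%N]p_halfE; lia.
rewrite -prod_one_sub_z (@big_cat_nat _ _ _ m.+1) //= [X in _ * (_ * X)]big_nat_rev /=.
have -> : \prod_(m.+1 <= i < p) (1 - z ^+ (m.+1 + p - i.+1)) =
    \prod_(1 <= k < m.+1) (1 - z ^- k).
  have e1 : (1 + m)%N = m.+1 by [].
  have e2 : (m.+1 + m)%N = p by rewrite [in RHS]p_halfE; lia.
  rewrite -[in index_iota m.+1 p]e1 big_addn.
  have -> : (p - m = m.+1)%N by lia.
  apply: eq_big_nat => k /andP[k1 km]; congr (1 - _).
  have -> : (m.+1 + p - (k + m).+1 = p - k)%N by lia.
  by rewrite expfB ?z_exp_p ?mul1r //; lia.
rewrite /sine_prod -prodrXl -[X in (-1) ^+ X](subn1 m.+1) -prodr_const_nat.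
rewrite -!big_split /=; apply: eq_bigr => k _.
rewrite -w2 -exprM mul2n -addnn exprD.
by have := expf_neq0 k w_neq0; move: (w ^+ k) => u u0; field.
Qed.

(** w^k - w^-k = - (1 - z) w^-k (1 + z + ... + z^(k-1)), and the last two factors have residues
    (-1)^k and k. *)
Lemma sine_prod_residue :
  exists2 y, sine_prod = (- (1 - z)) ^+ m * y &
    residue y ((-1) ^+ (\sum_(1 <= k < m.+1) k) * (m`!)%:R).
Proof.
exists (\prod_(1 <= k < m.+1) (w^-1 ^+ k * \sum_(i < k) z ^+ i)).
  rewrite /sine_prod -[X in _ ^+ X](subn1 m.+1) -prodr_const_nat -big_split /=.
  apply: eq_bigr => k _; rewrite mulrCA opprB -subrX1 -w2 -exprM mul2n -addnn exprD exprVn.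
  by have := expf_neq0 k w_neq0; move: (w ^+ k) => u u0; field.
have -> : (-1) ^+ (\sum_(1 <= k < m.+1) k) * (m`!)%:R =
    \prod_(1 <= k < m.+1) ((-1) ^+ k * \sum_(i < k) 1) :> 'F_p.
  rewrite big_split /= -expr_sum fact_prod natr_prod; congr (_ * _).
  by apply: eq_bigr => k _; rewrite sumr_const card_ord.
apply: residue_prod => k _; apply: residueM.
  by apply: residueX; rewrite w_inv; apply: residueN; exact: residue_echar.
by apply: residue_sum => i _; rewrite -echar_nat; exact: residue_echar.
Qed.

(** The falling factorial X (X - 1) ... (X - k + 1), that is k! times the binomial polynomial. *)
Definition ffact_poly k : {poly 'F_p} := \prod_(i < k) ('X - (i%:R)%:P).

Lemma size_ffact_poly k : size (ffact_poly k) = k.+1.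
Proof. by rewrite /ffact_poly size_prod_XsubC [index_enum _]unlock -enumT size_enum_ord. Qed.

Lemma ffact_poly_monic k : ffact_poly k \is monic.
Proof. exact: monic_prod_XsubC. Qed.

Lemma horner_ffact_poly k n : (ffact_poly k).[n%:R] = (n ^_ k)%:R.
Proof.
elim: k => [|k IHk]; first by rewrite /ffact_poly big_ord0 hornerC.
rewrite /ffact_poly big_ord_recr /= hornerM -/(ffact_poly k) IHk hornerXsubC ffactnSr natrM.
have [kn|nk] := leqP k n; first by rewrite natrB.
by rewrite ffact_small // !mul0r.
Qed.

(** By Euler's criterion this is a combination of power sums of degrees m to m + k, at most p - 1.
    All vanish except in degree p - 1, reached only for k = m with leading coefficient 1. *)
Lemma sum_eta_ffact k : (k <= m)%N ->
  (\sum_(j : 'F_p) eta j * (j ^_ k)%:Z)%:~R = - (k == m)%:R :> 'F_p.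
Proof.
move=> km; rewrite rmorph_sum /=.
transitivity (\sum_(j : 'F_p) j ^+ m * (ffact_poly k).[j]).
  apply: eq_bigr => j _; rewrite rmorphM /= eta_euler; congr (_ * _).
  by rewrite -[in RHS](natr_Zp j) horner_ffact_poly.
transitivity (\sum_(i < k.+1) (ffact_poly k)`_i * \sum_(j : 'F_p) j ^+ (m + i)).
  rewrite -[in RHS](size_ffact_poly k); under eq_bigr do rewrite horner_coef mulr_sumr.
  rewrite exchange_big /=; apply: eq_bigr => i _; rewrite mulr_sumr.
  by apply: eq_bigr => j _; rewrite exprD; ring.
have pm : p.-1 = (m + m)%N by rewrite [in LHS]p_halfE addnn.
rewrite big_ord_recr /= big1 ?add0r => [|i _]; last first.
  rewrite sum_Fp_pow ?mulr0 // pm; have := ltn_ord i; have := half_gt0; lia.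
have -> : (ffact_poly k)`_k = 1.
  by have /monicP := ffact_poly_monic k; rewrite /lead_coef size_ffact_poly.
rewrite mul1r; case: (eqVneq k m) => [->|kNm]; first by rewrite -pm sum_Fp_pow_pred.
by rewrite sum_Fp_pow ?oppr0 // pm; have := half_gt0; lia.
Qed.

Lemma Fp_fact_neq0 k : (k < p)%N -> (k`!)%:R != 0 :> 'F_p.
Proof.
move=> kp; rewrite -(dvdn_pcharf (pchar_Fp p_prime)); apply: contraTN kp.
by rewrite -leqNgt; elim: k => [|k IHk]; rewrite ?fact0 ?dvdn1 ?factS ?Euclid_dvdM //;
  [move/eqP=> p1; have := prime_gt1 p_prime; rewrite p1
  | case/orP=> [/dvdn_leq->|/IHk/leqW]].
Qed.

(* Expand z^j = (1 - (1 - z))^j; by Euler's criterion the coefficient of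
   (z - 1)^k is, mod p, a power sum of degree m + k, zero for k < m. *)
Lemma gauss_residue :
  exists2 y, gauss = (- (1 - z)) ^+ m * y &
    exists2 r, residue y r & r * (m`!)%:R = -1.
Proof.
pose g k : int := \sum_(j : 'F_p) eta j * ('C(j, k))%:Z.
have gE k : (g k)%:~R * (k`!)%:R = (\sum_(j : 'F_p) eta j * (j ^_ k)%:Z)%:~R :> 'F_p.
  rewrite -[_%:R]/((k`!)%:Z%:~R) -rmorphM /= /g mulr_suml; congr _%:~R.
  by apply: eq_bigr => j _; rewrite -mulrA -PoszM bin_ffact.
have mp : (m < p)%N by rewrite [X in (_ < X)%N]p_halfE; lia.
set pi := - (1 - z).
have gaussE : gauss = \sum_(k < p) (g k)%:~R * pi ^+ k.
  rewrite /gauss /g; under [RHS]eq_bigr do rewrite rmorph_sum mulr_suml.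
  rewrite exchange_big /=; apply: eq_bigr => j _.
  under eq_bigr do rewrite rmorphM /= -mulrA; rewrite -mulr_sumr; congr (_ * _).
  have jp : (j.+1 <= p)%N by exact: ord_lt_p.
  rewrite /e; have -> : z = 1 + pi by rewrite /pi opprB addrC subrK.
  rewrite exprDn (big_ord_widen p (fun i => (1 ^+ (j - i) * pi ^+ i) *+ 'C(j, i))) //.
  rewrite [RHS](bigID (fun i : 'I_p => (i < j.+1)%N)) /= [X in _ = _ + X]big1 ?addr0.
    by apply: eq_bigr => i _; rewrite expr1n mul1r mulr_natl.
  by move=> i; rewrite -leqNgt => ji; rewrite bin_small ?mul0r.
pose good x r := exists2 y, x = pi ^+ m * y & residue y r.
have piR : residue pi 0.
  by rewrite /pi -[0]oppr0; apply: residueN; exact: residue_one_sub_z.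
have gk k : good ((g k)%:~R * pi ^+ k) (if k == m then (g m)%:~R else 0).
  have [km|km|->] := ltngtP k m.
  (* For k < m the coefficient is divisible by p, hence by pi^(p-1) = pi^(2m), so the quotient by
     pi^m still has residue 0. *)
  - have : (g k)%:~R == 0 :> 'F_p.
      have /eqP := gE k; rewrite sum_eta_ffact 1?ltnW // (ltn_eqF km) oppr0 mulf_eq0.
      by rewrite (negPf (Fp_fact_neq0 _)) ?orbF // (ltn_trans km).
    rewrite -(dvdz_pcharf (pchar_Fp p_prime)) => /dvdzP[h hE].
    have [v vE [r vr]] := one_sub_z_exp_dvd_p.
    exists (pi ^+ m * (h%:~R * pi ^+ k * v)).
      have -> : (g k)%:~R = h%:~R * (1 - z) ^+ p.-1 * v by rewrite hE rmorphM /= -mulrA -vE.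
      have -> : (1 - z) ^+ p.-1 = pi ^+ m * pi ^+ m.
        rewrite -exprD addnn -{1}[1 - z]opprK -/pi [in p.-1]p_halfE /= -muln2 mulnC !exprM.
        by rewrite sqrrN.
      by ring.
    rewrite -[X in residue _ X](mul0r (h%:~R * 0 ^+ k * r)); apply: residueM.
      by have := residueX m piR; rewrite expr0n eqn0Ngt half_gt0.
    by do 2! apply: residueM => //; [exact: residue_int | exact: residueX].
  - exists ((g k)%:~R * pi ^+ (k - m)).
      by rewrite mulrCA -exprD subnKC // ltnW.
    rewrite -[X in residue _ X](mulr0 (g k)%:~R); apply: residueM; first exact: residue_int.
    by have := residueX (k - m) piR; rewrite expr0n subn_eq0 leqNgt km.
  - by exists (g m)%:~R; [rewrite mulrC | exact: residue_int].
have : good gauss (\sum_(k < p) if k == m :> nat then (g m)%:~R else 0).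
  rewrite gaussE; apply: (big_ind2 good) => [|x1 r1 x2 r2 [y1 -> yr1] [y2 -> yr2]|k _].
  - by exists 0; [rewrite mulr0 | exact: (residue_nat 0)].
  - by exists (y1 + y2); [rewrite mulrDr | exact: residueD].
  - exact: gk.
rewrite (bigD1 (Ordinal mp)) //= eqxx big1 ?addr0 => [|k]; last first.
  by rewrite -val_eqE /= => /negPf ->.
move=> [y yE yr]; exists y => //; exists (g m)%:~R => //.
by rewrite gE sum_eta_ffact // eqxx.
Qed.

(** Wilson's theorem, after reflecting the upper half of (p-1)! by k -> p - k. *)
Lemma half_fact_sqr : (m`!)%:R ^+ 2 = (-1) ^+ m.+1 :> 'F_p.
Proof.
have W : ((p.-1)`!)%:R = -1 :> 'F_p.
  apply/eqP; rewrite -addr_eq0 -[1]/(1%:R) -natrD addn1 -(dvdn_pcharf (pchar_Fp p_prime)).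
  by rewrite -Wilson // prime_gt1.
have pm : p.-1 = m.*2 by rewrite [in LHS]p_halfE.
have : ((p.-1)`!)%:R = (-1) ^+ m * (m`!)%:R ^+ 2 :> 'F_p.
  rewrite !fact_prod natr_prod (@big_cat_nat _ _ _ m.+1) //=; last by rewrite pm; lia.
  rewrite expr2 mulrCA natr_prod; congr (_ * _).
  rewrite big_nat_rev /= -[X in (-1) ^+ X](subn1 m.+1) -prodr_const_nat -big_split /=.
  have e1 : (1 + m)%N = m.+1 by [].
  have e2 : (m.+1 + m)%N = p by rewrite [in RHS]p_halfE; lia.
  rewrite (ltn_predK (prime_gt0 p_prime)) -[in index_iota m.+1 p]e1 big_addn.
  have -> : (p - m = m.+1)%N by lia.
  apply: eq_big_nat => k /andP[k1 km].
  have -> : (m.+1 + p - (k + m).+1 = p - k)%N by lia.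
  by rewrite natrB ?pchar_Fp_0 ?sub0r ?mulN1r //; rewrite -e2; lia.
by move=> E; rewrite -[LHS](signrMK m) -E W mulrC -exprS.
Qed.

(** The squares agree, so only a sign b is open. Dividing both sides by the m-th power of - (1 - z)
    and comparing residues, multiplied by m!, determines b because 1 and -1 differ modulo p. *)
Lemma gauss_sine_prod :
  gauss = (-1) ^+ (m + \sum_(1 <= k < m.+1) k) * sine_prod.
Proof.
have [y gE [r yr rE]] := gauss_residue; have [q sE qr] := sine_prod_residue.
set T := \sum_(1 <= k < m.+1) k in qr *.
have [b bE] : exists b : bool, gauss = (-1) ^+ b * sine_prod.
  have : gauss ^+ 2 == sine_prod ^+ 2 by rewrite gauss_sqr sine_prod_sqr.
  by rewrite eqf_sqr => /orP[] /eqP ->; [exists false | exists true]; rewrite ?mul1r ?mulN1r.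
rewrite bE; congr (_ * _).
have yq : y = (-1) ^+ b * q.
  have pi0 : (- (1 - z)) ^+ m != 0 by rewrite expf_neq0 // oppr_eq0 one_sub_z_neq0.
  by apply: (mulfI pi0); rewrite -gE bE sE; ring.
have rb : r = (-1) ^+ b * ((-1) ^+ T * (m`!)%:R).
  apply: residue_uniq yr _; rewrite yq; apply: residueM => //.
  by have := residueX b (residue_int (-1)); rewrite !rmorphN1.
move: rE; rewrite rb -!mulrA -expr2 half_fact_sqr exprS mulN1r !mulrN.
move/oppr_inj; rewrite -!exprD => bTm.
have : ~~ odd (b + (T + m)).
  apply/negP => o; move: bTm; rewrite -signr_odd o expr1 => /eqP.
  by rewrite Fp_N1_neq1.
by rewrite -[RHS]signr_odd !oddD oddb; case: b {bE yq rb bTm}; case: (odd T); case: (odd m).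
Qed.

End GaussSign.

(** * Characters of F_p^n *)

Section Fourier.

Variable n : nat.
Local Notation V := 'rV['F_p]_n.
Implicit Types (x y a b : V).

Lemma dotC x y : dot x y = dot y x.
Proof. by apply: eq_bigr => i _; rewrite mulrC. Qed.

Lemma dotDr x y a : dot x (y + a) = dot x y + dot x a.
Proof. by rewrite -big_split; apply: eq_bigr => i _; rewrite mxE mulrDr. Qed.

Lemma dotZr (t : 'F_p) x y : dot x (t *: y) = t * dot x y.
Proof. by rewrite mulr_sumr; apply: eq_bigr => i _; rewrite mxE mulrCA. Qed.

Lemma dotNr x y : dot x (- y) = - dot x y.
Proof. by rewrite -scaleN1r dotZr mulN1r. Qed.

Lemma dot0r x : dot x 0 = 0.
Proof. by rewrite -(scale0r (0 : V)) dotZr mul0r. Qed.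

Lemma dotDl x y a : dot (x + y) a = dot x a + dot y a.
Proof. by rewrite !(dotC _ a) dotDr. Qed.

Lemma dotZl (t : 'F_p) x y : dot (t *: x) y = t * dot x y.
Proof. by rewrite !(dotC _ y) dotZr. Qed.

Lemma dotNl x y : dot (- x) y = - dot x y.
Proof. by rewrite !(dotC _ y) dotNr. Qed.

Lemma dot0l x : dot 0 x = 0.
Proof. by rewrite dotC dot0r. Qed.

Lemma card_rVp : #|{: V}| = (p ^ n)%N.
Proof. by rewrite card_mx mul1n card_Fp. Qed.

Definition subspace (S : {set V}) := exists U : {vspace V}, S = [set x | x \in U].

Lemma subspace0 S : subspace S -> 0 \in S.
Proof. by case=> U ->; rewrite inE mem0v. Qed.

Lemma subspaceD S x y : subspace S -> y \in S -> (x + y \in S) = (x \in S).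
Proof. by case=> U ->; rewrite !inE => yU; rewrite rpredDr. Qed.

Lemma subspaceN S x : subspace S -> (- x \in S) = (x \in S).
Proof. by case=> U ->; rewrite !inE rpredN. Qed.

Lemma subspaceZ S (t : 'F_p) x : subspace S -> t != 0 -> (t *: x \in S) = (x \in S).
Proof. by case=> U -> t0; rewrite !inE rpredZeq (negPf t0). Qed.

Lemma in_orthcP (S : {set V}) a : reflect (forall y, y \in S -> dot a y = 0) (a \in orthc S).
Proof. by rewrite inE; apply: (iffP forall_inP) => H y /H /eqP. Qed.

Lemma orthcP (S : {set V}) a :
  {y | y \in S & dot a y != 0} + {a \in orthc S}.
Proof.
have [aS|] := boolP (a \in orthc S); first by right.
rewrite inE negb_forall_in => aS; left.
by have /sig2W[y yS ay] := exists_inP aS; exists y.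
Qed.

Lemma orthcN (S : {set V}) x : (- x \in orthc S) = (x \in orthc S).
Proof. by apply/in_orthcP/in_orthcP => H a /H aS; apply/eqP; move/eqP: aS; rewrite dotNl oppr_eq0. Qed.

Lemma orthc0 (S : {set V}) : 0 \in orthc S.
Proof. by apply/in_orthcP => y _; rewrite dot0l. Qed.

Lemma subspace_char_sum S a : subspace S ->
  \sum_(x in S) e (dot x a) = if a \in orthc S then #|S|%:R else 0.
Proof.
move=> Ssub; case: (orthcP S a) => [[y yS ay]|aS]; last first.
  rewrite aS -sum1_card natr_sum; apply: eq_bigr => x xS.
  by move/in_orthcP: aS => /(_ x xS) ax; rewrite dotC ax echar0.
have -> : (a \in orthc S) = false.
  by apply/negP => /in_orthcP /(_ y yS) /eqP; rewrite (negPf ay).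
have ey1 : e (dot y a) != 1 by rewrite -echar0 (inj_eq echar_inj) dotC.
apply: (mulIf (x := e (dot y a) - 1)); first by rewrite subr_eq0.
rewrite mul0r mulrBr mulr1; apply/eqP; rewrite subr_eq0; apply/eqP.
rewrite mulr_suml [RHS](@reindex_inj _ _ _ V (fun x => x + y) _ _ (addIr y)) /=.
apply: eq_big => [x|x _]; first by rewrite subspaceD.
by rewrite dotDl echarD.
Qed.

Lemma char_sum a : \sum_x e (dot x a) = if a == 0 then (p ^ n)%:R else 0.
Proof.
have sT : subspace [set: V] by exists fullv; apply/setP => x; rewrite !inE memvf.
have := subspace_char_sum a sT; rewrite cardsT card_rVp.
have -> : (a \in orthc [set: V]) = (a == 0).
  apply/in_orthcP/eqP => [H|-> y _]; last by rewrite dot0l.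
  apply/rowP => i; rewrite mxE -(H (delta_mx 0 i)) ?inE // /dot (bigD1 i) //=.
  rewrite mxE !eqxx mulr1 big1 ?addr0 // => j ji.
  by rewrite mxE eqxx (negPf ji) mulr0.
by move=> <-; apply: eq_bigl => x; rewrite inE.
Qed.

Lemma fourier_inversion (F : V -> C) y :
  \sum_a (\sum_x F x * e (dot x a)) * e (- dot a y) = (p ^ n)%:R * F y.
Proof.
under eq_bigr do rewrite mulr_suml; rewrite exchange_big /=.
transitivity (\sum_x F x * (if x - y == 0 then (p ^ n)%:R else 0)).
  apply: eq_bigr => x _; rewrite -char_sum mulr_sumr; apply: eq_bigr => a _.
  by rewrite -mulrA -echarD dotDr dotNr dotC.
rewrite (bigD1 y) //= subrr eqxx big1 ?addr0 1?mulrC // => x xy.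
by rewrite subr_eq0 (negPf xy) mulr0.
Qed.

Lemma pn_neq0 : ((p ^ n)%:R : C) != 0.
Proof. by rewrite pnatr_eq0 -lt0n expn_gt0 prime_gt0. Qed.

(** Fourier inversion for the indicator of S, whose transform is |S| times the indicator of the
    orthogonal. *)
Lemma orthc_char_sum S a : subspace S ->
  #|S|%:R * \sum_(x in orthc S) e (dot x a) = if a \in S then (p ^ n)%:R else 0.
Proof.
move=> Ssub.
have := fourier_inversion (fun x => (x \in S)%:R) a.
rewrite [RHS]mulr_natr mulrb => <-.
transitivity (\sum_x (if x \in orthc S then #|S|%:R * e (dot x a) else 0)).
  by rewrite mulr_sumr big_mkcond.
rewrite (@reindex_inj _ _ _ V -%R _ _ oppr_inj) /=; apply: eq_bigr => b _.
rewrite orthcN dotNl.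
transitivity ((\sum_(x in S) e (dot x b)) * e (- dot b a)).
  by rewrite subspace_char_sum //; case: ifP; rewrite ?mul0r.
by congr (_ * _); rewrite big_mkcond; apply: eq_bigr => x _; case: ifP; rewrite ?mul1r ?mul0r.
Qed.

Lemma card_orthc S : subspace S -> (#|S| * #|orthc S|)%N = (p ^ n)%N.
Proof.
move=> Ssub; apply/eqP; rewrite -(eqr_nat C); have := orthc_char_sum 0 Ssub.
rewrite subspace0 // => <-; rewrite natrM -[#|orthc S|]sum1_card natr_sum; apply/eqP.
by congr (_ * _); apply: eq_bigr => x _; rewrite dot0r echar0.
Qed.

(** The condition f x = j is detected by summing e(c (f x - j)) over all c. *)
Lemma level_char_sum (P : pred V) (f : V -> 'F_p) j a :
  p%:R * \sum_(x | P x && (f x == j)) e (dot x a) =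
  \sum_(c : 'F_p) e (- (c * j)) * \sum_(x | P x) e (c * f x + dot x a).
Proof.
under [RHS]eq_bigr do rewrite mulr_sumr; rewrite exchange_big mulr_sumr /= big_mkcondr /=.
apply: eq_bigr => x _.
transitivity (e (dot x a) * \sum_(c : 'F_p) e ((f x - j) * c)).
  by rewrite sum_echar_mul subr_eq0; case: ifP => _; rewrite ?mulr0 // mulrC.
rewrite mulr_sumr; apply: eq_bigr => c _; rewrite -!echarD; congr echar; ring.
Qed.

(* With S^\bot \subset A and A = B_+(f^* ), the values encode the classes of U12
   and U13: inl true is {0}, inl false is S^\bot \ {0}, and inr (b, j) is the
   rest of c_j(f) if b, and d_j(f) otherwise. *)
Definition kind (A S : {set V}) (f : V -> 'F_p) x : bool + bool * 'F_p :=
  if x == 0 then inl true else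
  if x \in orthc S then inl false else inr (x \in A, f x).

Lemma kind0 A S f x : (kind A S f x == inl true) = (x == 0).
Proof. by rewrite /kind; have [_|_] := eqVneq x 0; last by case: ifP. Qed.

(** [kind] forgets membership in A and the value of f on [orthc S], but both are constant there by
    the hypotheses. *)
Lemma kind_eq (A S : {set V}) (f : V -> 'F_p) x y :
  orthc S \subset A -> {in orthc S, forall u, f u = 0} ->
  kind A S f x = kind A S f y ->
  [/\ (x == 0) = (y == 0), (x \in orthc S) = (y \in orthc S),
      (x \in A) = (y \in A) & f x = f y].
Proof.
move=> /subsetP SA f0; have S0 := orthc0 S; rewrite /kind.
have [->|x0] := eqVneq x 0; have [->|y0] := eqVneq y 0 => //.
- by case: ifP.
- by case: ifP.
case: ifP => xS; case: ifP => yS //; last by case=> -> ->.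
by move=> _; rewrite !SA // !f0.
Qed.

(** * Character sums over the classes *)

Section KindSums.

Variables (A B : {set V}) (f g : V -> 'F_p).
Hypotheses (Asub : subspace A) (Bsub : subspace B).
Hypotheses (BA : orthc B \subset A) (fB : {in orthc B, forall x, f x = 0}).
Hypotheses (AB : orthc A \subset B) (gA : {in orthc A, forall x, g x = 0}).
Hypothesis sumA : forall (c : 'F_p) a b, c != 0 -> (a \in B) = (b \in B) -> g a = g b ->
  \sum_(x in A) e (c * f x + dot x a) = \sum_(x in A) e (c * f x + dot x b).
Hypothesis sumAC : forall (c : 'F_p) a b, c != 0 -> (a \in B) = (b \in B) -> g a = g b ->
  \sum_(x | x \notin A) e (c * f x + dot x a) = \sum_(x | x \notin A) e (c * f x + dot x b).

(** One direction of the duality. In the level formula, c = 0 gives sums over the subspace A or its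
    complement, and c != 0 is covered by [sumA] and [sumAC]. *)
Lemma kind_char_sum a b : kind B A g a = kind B A g b ->
  forall k, \sum_(x | kind A B f x == k) e (dot x a) =
            \sum_(x | kind A B f x == k) e (dot x b).
Proof.
move=> /(kind_eq AB gA)[ab0 abA abB abg].
have eqA : \sum_(x in A) e (dot x a) = \sum_(x in A) e (dot x b).
  by rewrite !subspace_char_sum // abA.
have eqAC : \sum_(x | x \notin A) e (dot x a) = \sum_(x | x \notin A) e (dot x b).
  have := char_sum a; rewrite ab0 -char_sum (bigID (fun x => x \in A)) /=.
  by rewrite [RHS](bigID (fun x => x \in A)) /= eqA => /addrI.
have eqB : \sum_(x in orthc B) e (dot x a) = \sum_(x in orthc B) e (dot x b).
  have B0 : (#|B|%:R : C) != 0.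
    by rewrite pnatr_eq0 -lt0n; apply/card_gt0P; exists 0; exact: subspace0.
  by apply: (mulfI B0); rewrite !orthc_char_sum // abB.
have p0 : (p%:R : C) != 0 by rewrite pnatr_eq0 -lt0n prime_gt0.
have levA j : \sum_(x | (x \in A) && (f x == j)) e (dot x a) =
              \sum_(x | (x \in A) && (f x == j)) e (dot x b).
  apply: (mulfI p0); rewrite !level_char_sum; apply: eq_bigr => c _; congr (_ * _).
  have [->|c0] := eqVneq c 0; last exact: sumA.
  by under [LHS]eq_bigr do rewrite mul0r add0r; under [RHS]eq_bigr do rewrite mul0r add0r.
have levAC j : \sum_(x | (x \notin A) && (f x == j)) e (dot x a) =
               \sum_(x | (x \notin A) && (f x == j)) e (dot x b).
  apply: (mulfI p0); rewrite !level_char_sum; apply: eq_bigr => c _; congr (_ * _).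
  have [->|c0] := eqVneq c 0; last exact: sumAC.
  by under [LHS]eq_bigr do rewrite mul0r add0r; under [RHS]eq_bigr do rewrite mul0r add0r.
(* Each class is a level set on A or off A, possibly with [orthc B] removed; since f vanishes on
   [orthc B], the removal only touches level 0. *)
have kE k F : \sum_(x | kind A B f x == k) F x = match k with
    | inl true => F 0
    | inl false => \sum_(x in orthc B) F x - F 0
    | inr (true, j) => \sum_(x | (x \in A) && (f x == j)) F x -
        (if j == 0 then \sum_(x in orthc B) F x else 0)
    | inr (false, j) => \sum_(x | (x \notin A) && (f x == j)) F x
    end :> C.
  case: k => [[]|[[] j]].
  - by under eq_bigl do rewrite kind0; rewrite big_pred1_eq.
  - rewrite [in RHS](bigD1 0) ?orthc0 //= [F 0 + _]addrC addrK; apply: eq_bigl => x.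
    by rewrite /kind; case: (eqVneq x 0) => _; rewrite ?andbF ?andbT //; case: ifP.
  - rewrite [in RHS](bigID (fun x => x \in orthc B)) /=.
    rewrite [X in X + _ - _](_ : _ = if j == 0 then \sum_(x in orthc B) F x else 0).
      rewrite [X in X - _]addrC addrK; apply: eq_bigl => x; rewrite /kind.
      case: (eqVneq x 0) => [->|x0]; first by rewrite orthc0 andbF.
      case: ifP => xB; first by rewrite andbF.
      by rewrite andbT; apply/eqP/andP => [[-> ->]|[-> /eqP ->]].
    rewrite (eq_bigl (fun x => (x \in orthc B) && (j == 0))).
      by case: (j == 0); [apply: eq_bigl => x; rewrite andbT | rewrite big_pred0 // => x; rewrite andbF].
    move=> x; have [xB|] := boolP (x \in orthc B); rewrite ?andbF //.
    by rewrite (subsetP BA) //= fB // andbT eq_sym.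
  - apply: eq_bigl => x; rewrite /kind; case: (eqVneq x 0) => [->|x0].
      by rewrite (subspace0 Asub).
    case: ifP => xB; first by rewrite (subsetP BA _ xB).
    by apply/eqP/andP => [[/negbT -> ->]|[/negPf -> /eqP ->]].
by move=> k; rewrite !kE !eqB !dot0l; case: k => [[]|[[] j]]; rewrite ?levA ?levAC.
Qed.

End KindSums.

(* The Fourier transform maps functions of kappa to functions of tau and back,
   and the latter are closed under products, so the former are closed under
   convolution. *)
Lemma convolution_classes (K K' : finType) (kappa : V -> K) (tau : V -> K') :
  (forall a b, tau a = tau b -> forall k,
     \sum_(x | kappa x == k) e (dot x a) = \sum_(x | kappa x == k) e (dot x b)) ->
  (forall x y, kappa x = kappa y -> forall k,
     \sum_(a | tau a == k) e (dot a x) = \sum_(a | tau a == k) e (dot a y)) ->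
  (forall x, kappa (- x) = kappa x) ->
  forall u v x y, kappa x = kappa y ->
    #|[set t | (kappa t == u) && (kappa (x - t) == v)]| =
    #|[set t | (kappa t == u) && (kappa (y - t) == v)]|.
Proof.
move=> Hk Ht kN u v x y xy.
pose N x : C := #|[set t | (kappa t == u) && (kappa (x - t) == v)]|%:R.
pose F u a : C := \sum_(x | kappa x == u) e (dot x a).
have NE a : \sum_x N x * e (dot x a) = F u a * F v a.
  rewrite /F big_distrlr /=.
  transitivity (\sum_x \sum_(t | kappa t == u) (kappa (x - t) == v)%:R * e (dot x a)).
    apply: eq_bigr => s _; rewrite -mulr_suml /N -sum1_card natr_sum; congr (_ * _).
    rewrite big_mkcond [RHS]big_mkcond; apply: eq_bigr => t _.
    by rewrite inE; case: eqP => //= _; case: eqP.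
  rewrite exchange_big /=; apply: eq_bigr => t _.
  rewrite (@reindex_inj _ _ _ V (fun s => s + t) _ _ (addIr t)) /= [RHS]big_mkcond.
  apply: eq_bigr => s _; rewrite addrK; case: eqP => _; last by rewrite mul0r.
  by rewrite mul1r dotDl echarD mulrC.
have inv s : (p ^ n)%:R * N s = \sum_k \sum_(a | tau a == k) F u a * F v a * e (dot a (- s)).
  rewrite -fourier_inversion (partition_big tau predT) //=; apply: eq_bigr => k _.
  by apply: eq_bigr => a _; rewrite NE dotNr.
suff : (p ^ n)%:R * N x = (p ^ n)%:R * N y.
  by move/(mulfI pn_neq0)/eqP; rewrite eqr_nat => /eqP.
rewrite !inv; apply: eq_bigr => k _.
case: (pickP (fun a => tau a == k)) => [a0 /eqP a0k | none]; last by rewrite !big_pred0.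
have cst s : \sum_(a | tau a == k) F u a * F v a * e (dot a (- s)) =
    F u a0 * F v a0 * \sum_(a | tau a == k) e (dot a (- s)).
  rewrite mulr_sumr; apply: eq_bigr => a /eqP ak.
  by rewrite /F !(Hk a a0) // ak a0k.
(* Inversion evaluates the characters at -x, hence the need for [kappa] to be even. *)
by rewrite !cst (Ht (- x) (- y)) // !kN.
Qed.

(** * Bent functions and their duals *)

Section DualPair.

Hypothesis n_odd : odd n.

(* mu p^(n/2), by the evaluation of the Gauss sum. *)
Definition Gam : C := p%:R ^+ n./2 * gauss.

Lemma Gam_sqr : Gam * Gam = (-1) ^+ m * (p ^ n)%:R.
Proof.
rewrite /Gam mulrACA -expr2 -exprM muln2 -expr2 gauss_sqr mulrCA -exprSr natrX.
by rewrite -[in RHS](odd_double_half n) n_odd.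
Qed.

Lemma Gam_neq0 : Gam != 0.
Proof. by rewrite mulf_neq0 ?gauss_neq0 // expf_neq0 // pnatr_eq0 -lt0n prime_gt0. Qed.

Lemma residue_Gam : exists k, residue Gam k.
Proof.
by have [k gk] := residue_gauss; exists (p%:R ^+ n./2 * k); apply: residueM => //;
  apply: residueX; exact: residue_nat.
Qed.

Lemma residue_sign k : residue ((-1) ^+ k) ((-1) ^+ k).
Proof. by have := residueX k (residue_int (-1)); rewrite !rmorphN1. Qed.

(** Once [Gam] is cancelled, the two equal terms add up to twice an element of Z[z]; parity gives
    equal exponents, then equal signs. *)
Lemma sign_Gam_inj (s t : bool) (i j : 'F_p) :
  (-1) ^+ s * Gam * e i = (-1) ^+ t * Gam * e j -> s = t /\ i = j.
Proof.
rewrite -!(mulrA _ Gam) !(mulrCA _ Gam) => /(mulfI Gam_neq0) E; have ij : i = j.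
  apply: (@two_dvd_echar s t i j ((-1) ^+ s * e i)); first exact: p_gt2.
    by exists ((-1) ^+ s * 1); apply: residueM; [exact: residue_sign | exact: residue_echar].
  by rewrite -E mulr2n.
split=> //; move: E; rewrite ij => /(mulIf (echar_neq0 _)).
exact: (@signr_inj C).
Qed.

(** With the Gauss sum expanded and moved to the left, the identity becomes an integer relation
    indexed by [I + 'F_p]. Conjugating it rescales the Gauss sum, which yields the factor
    [eta c]. *)
Lemma galois_gauss (I : finType) (P : pred I) (phi : I -> 'F_p) (t : int) k c :
  c != 0 -> \sum_(i | P i) e (phi i) = t%:~R * Gam * e k ->
  \sum_(i | P i) e (c * phi i) = t%:~R * (eta c)%:~R * Gam * e (c * k).
Proof.
move=> c0 E.
pose a (u : I + 'F_p) : int :=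
  match u with inl _ => 1 | inr j => - (t * p%:Z ^+ n./2 * eta j) end.
pose psi (u : I + 'F_p) := match u with inl i => phi i | inr j => j + k end.
pose Q (u : I + 'F_p) := match u with inl i => P i | inr _ => true end.
have aE (F : 'F_p -> C) : \sum_(u | Q u) (a u)%:~R * F (psi u) =
    \sum_(i | P i) F (phi i) -
    t%:~R * p%:R ^+ n./2 * \sum_(j : 'F_p) (eta j)%:~R * F (j + k).
  rewrite big_sumType /= mulr_sumr -sumrN; congr (_ + _); apply: eq_bigr => j _.
    by rewrite mul1r.
  by rewrite rmorphN !rmorphM rmorphXn /= mulNr -!mulrA.
have : \sum_(u | Q u) (a u)%:~R * e (psi u) = 0.
  rewrite aE E; apply/eqP; rewrite subr_eq0; apply/eqP.
  rewrite /Gam /gauss -!mulrA mulr_suml; do 2!congr (_ * _).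
  by apply: eq_bigr => j _; rewrite echarD mulrA.
move/(galois_echar c0); rewrite (aE (fun u => e (c * u))) => /eqP; rewrite subr_eq0 => /eqP ->.
rewrite /Gam -(mulrA t%:~R) -!(mulrCA (p%:R ^+ _)) -!mulrA; congr (_ * (_ * _)).
rewrite !mulrA -gauss_scale // mulr_suml; apply: eq_bigr => j _.
by rewrite mulrDr echarD mulrA.
Qed.

Definition wtrans (f : V -> 'F_p) a : C := \sum_x e (f x - dot a x).

Lemma residue_wtrans f a : exists k, residue (wtrans f a) k.
Proof. by exists (\sum_(x : V) 1); apply: residue_sum => x _; exact: residue_echar. Qed.

Lemma bent_value f a : wtrans f a * (wtrans f a)^* = p%:R ^+ n ->
  exists (s : bool) k, wtrans f a = (-1) ^+ s * Gam * e k.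
Proof. by apply: sqrt_odd_power => //; exact: residue_wtrans. Qed.

Lemma wtransN f a : wtrans f (- a) = \sum_x e (f x + dot a x).
Proof. by apply: eq_bigr => x _; rewrite dotNl opprK. Qed.

Lemma wtrans_inversion f y : \sum_a wtrans f a * e (dot a y) = (p ^ n)%:R * e (f y).
Proof.
rewrite -(fourier_inversion (fun x => e (f x))).
rewrite (@reindex_inj _ _ _ V -%R _ _ oppr_inj) /=; apply: eq_bigr => a _.
rewrite wtransN dotNl; congr (_ * _).
by apply: eq_bigr => x _; rewrite echarD dotC.
Qed.

(** * A bent function [f], its dual [g], the dual [fdd] of [g], and the sign sets; a sign is true
    for minus *)

Variables (f g fdd : V -> 'F_p) (sf sg : V -> bool).
Hypothesis Wf : forall a, wtrans f a = (-1) ^+ sf a * Gam * e (g a).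
Hypothesis Wg : forall x, wtrans g x = (-1) ^+ sg x * Gam * e (fdd x).

(* A is B_+(g); B is B_+(f) if p = 1 mod 4 and B_-(f) if p = 3 mod 4. *)
Let A := [set x | ~~ sg x].
Let B := [set a | sf a == odd m].

(** Fourier inversion for [f]; [Gam_sqr] turns the division by [Gam] into a multiplication. *)
Lemma signed_sum_g y :
  \sum_a (-1) ^+ sf a * e (g a + dot a y) = (-1) ^+ m * Gam * e (f y).
Proof.
apply: (mulfI Gam_neq0); rewrite mulrA mulrCA Gam_sqr signrMK -wtrans_inversion.
by rewrite mulr_sumr; apply: eq_bigr => a _; rewrite Wf echarD; ring.
Qed.

(* Adding the Fourier inversion formula, whose terms carry the signs of f, to
   the Walsh transform of g keeps only the terms of B. *)
Lemma sum_B_twice y : (\sum_(a in B) e (g a + dot a y)) *+ 2 =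
  Gam * ((-1) ^+ false * e (f y) + (-1) ^+ sg (- y) * e (fdd (- y))).
Proof.
rewrite mulrDr mul1r; have <- : wtrans g (- y) = Gam * ((-1) ^+ sg (- y) * e (fdd (- y))).
  by rewrite Wg -mulrA mulrCA.
have -> : Gam * e (f y) = \sum_a (-1) ^+ m * (-1) ^+ sf a * e (g a + dot a y).
  rewrite -[LHS](signrMK m) (mulrA _ Gam) -signed_sum_g.
  by rewrite mulr_sumr; apply: eq_bigr => a _; rewrite mulrA.
rewrite wtransN -big_split /= -sumrMnl [RHS](bigID (fun a => a \in B)) /= [X in _ = _ + X]big1 ?addr0.
  apply: eq_bigr => a; rewrite inE => /eqP ->.
  by rewrite -[(-1) ^+ m]signr_odd -signr_addb addbb mul1r dotC mulr2n.
move=> a; rewrite inE => sa; rewrite -[(-1) ^+ m]signr_odd -signr_addb dotC.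
have -> : odd m (+) sf a = true by move: sa; case: (odd m); case: (sf a).
by rewrite mulN1r addNr.
Qed.

(** [sum_B_twice] says that [Gam * T] is even in Z[z]. Multiplying by [Gam] gives up to sign p^n T,
    and p^n is odd, so T is even and its two exponents agree. *)
Lemma double_dual y : fdd (- y) = f y.
Proof.
apply/esym; have [k Gk] := residue_Gam.
set S := \sum_(a in B) e (g a + dot a y); have [l Sl] : exists l, residue S l.
  by exists (\sum_(a in B) 1); apply: residue_sum => a _; exact: residue_echar.
set T := (-1) ^+ false * e (f y) + (-1) ^+ sg (- y) * e (fdd (- y)).
have Tk : exists k, residue T k.
  by exists ((-1) ^+ false * 1 + (-1) ^+ sg (- y) * 1); apply: residueD; apply: residueM;
    first [exact: residue_sign | exact: residue_echar].
case: Tk => t Tt.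
(* Half of T = p^n T - (p^n - 1) T. *)
apply: (@two_dvd_echar false (sg (- y)) _ _ ((-1) ^+ m * (S * Gam) - ((p ^ n)./2)%:R * T)).
- exact: p_gt2.
- exists ((-1) ^+ m * (l * k) - ((p ^ n)./2)%:R * t); apply: residueB; apply: residueM => //.
  + exact: residue_sign.
  + exact: residueM.
  + exact: residue_nat.
have podd : odd (p ^ n) by rewrite oddX p_odd orbT.
rewrite -/T mulrnBl -mulrnAr -mulrnAl sum_B_twice -/T mulrAC Gam_sqr !mulrA -expr2 sqrr_sign mul1r.
rewrite -mulrnAl -mulrnA muln2 -mulrBl -[in X in X - _](odd_double_half (p ^ n)) podd.
by rewrite natrD addrK mul1r.
Qed.

Hypothesis (Asub : subspace A).

(** By [double_dual] the two terms of [sum_B_twice] coincide or cancel according to the sign of g at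
    -y, and A is stable under negation. *)
Lemma sum_B y :
  \sum_(a in B) e (g a + dot a y) = if y \in A then Gam * e (f y) else 0.
Proof.
have two0 : (2%:R : C) != 0 by rewrite pnatr_eq0.
apply: (mulIf two0); rewrite mulr_natr sum_B_twice double_dual -(subspaceN y Asub) inE.
by case: (sg (- y)); rewrite /= ?expr0 ?expr1; ring.
Qed.

Lemma sum_BC y :
  \sum_(a | a \notin B) e (g a + dot a y) = if y \in A then 0 else - Gam * e (f y).
Proof.
have : wtrans g (- y) = \sum_(a in B) e (g a + dot a y) + \sum_(a | a \notin B) e (g a + dot a y).
  by rewrite wtransN (bigID (fun a => a \in B)) /=; congr (_ + _); apply: eq_bigr => a _; rewrite dotC.
rewrite sum_B Wg double_dual -(subspaceN y Asub) inE.
case: (sg (- y)) => /=; first by rewrite expr1 add0r => <-; ring.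
by rewrite expr0 mul1r -[LHS]addr0 => /addrI.
Qed.

Hypothesis (Bsub : subspace B).
Hypothesis (f_even : forall x, f (- x) = f x) (f0 : f 0 = 0).

Lemma wtrans_even a : wtrans f (- a) = wtrans f a.
Proof.
rewrite wtransN /wtrans (@reindex_inj _ _ _ V -%R _ _ oppr_inj) /=.
by apply: eq_bigr => x _; rewrite f_even dotNr.
Qed.

Lemma g_even a : g (- a) = g a.
Proof.
by have := wtrans_even a; rewrite !Wf => /sign_Gam_inj[].
Qed.

(** [sum_B] gives the transform of e(g) restricted to B, supported on A; Fourier inversion recovers
    the sums over A. *)
Lemma sum_A a :
  \sum_(x in A) e (f x + dot x a) = if a \in B then (-1) ^+ m * Gam * e (g a) else 0.
Proof.
apply: (mulfI Gam_neq0).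
transitivity ((p ^ n)%:R * (if a \in B then e (g a) else 0)); last first.
  case: ifP => _; last by rewrite !mulr0.
  by rewrite mulrA mulrCA Gam_sqr signrMK.
rewrite -g_even -(subspaceN a Bsub) -(fourier_inversion (fun b => if b \in B then e (g b) else 0)).
rewrite mulr_sumr big_mkcond; apply: eq_bigr => x _; rewrite dotNr opprK.
have -> : \sum_b (if b \in B then e (g b) else 0) * e (dot b x) =
    \sum_(b in B) e (g b + dot b x).
  by rewrite [RHS]big_mkcond; apply: eq_bigr => b _; rewrite echarD; case: ifP; rewrite ?mul0r.
by rewrite sum_B; case: ifP => _; rewrite ?mul0r // echarD mulrA.
Qed.

Lemma sum_AC a :
  \sum_(x | x \notin A) e (f x + dot x a) =
  if a \in B then 0 else - ((-1) ^+ m * Gam * e (g a)).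
Proof.
have : wtrans f a = \sum_(x in A) e (f x + dot x a) + \sum_(x | x \notin A) e (f x + dot x a).
  rewrite -wtrans_even wtransN (bigID (fun x => x \in A)) /=.
  by congr (_ + _); apply: eq_bigr => x _; rewrite dotC.
rewrite sum_A Wf inE -[(-1) ^+ m]signr_odd; case: eqP => [->|/eqP sa].
  by rewrite -[LHS]addr0 => /addrI.
rewrite add0r => <-; case: (odd m) (sf a) sa => [] [] //= _; rewrite ?expr0 ?expr1; ring.
Qed.

(* Mod 2, the sum of the e (f x) is e (f 0) = 1, and gauss is the sum of all
   e j with j != 0, that is -1. *)
Lemma dual0 : g 0 = 0.
Proof.
have [q [k qk] qE] : exists2 q, exists k, residue q k & wtrans f 0 = 1 + q *+ 2.
  (* [h] selects one point of each pair x, -x, on which the even f agrees; only x = 0 is left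
     alone. *)
  pose h x := (enum_rank x < enum_rank (- x))%N.
  exists (\sum_(x | h x) e (f x)).
    by exists (\sum_(x | h x) 1); apply: residue_sum => x _; exact: residue_echar.
  have -> : wtrans f 0 = \sum_x e (f x) by apply: eq_bigr => x _; rewrite dot0l subr0.
  have neqN x : x != 0 -> x != - x.
    apply: contraNneq => xN; have : 2%:R *: x = 0 by rewrite scaler_nat mulr2n {2}xN subrr.
    move/eqP; rewrite scaler_eq0 -(dvdn_pcharf (pchar_Fp p_prime)) gtnNdvd ?p_gt2 //.
  rewrite (bigD1 0) //= f0 echar0; congr (_ + _).
  rewrite (bigID h) /= mulr2n; congr (_ + _).
    apply: eq_bigl => x; rewrite /h; case: (eqVneq x 0) => //= ->.
    by rewrite oppr0 ltnn.
  rewrite (@reindex_inj _ _ _ V -%R _ _ oppr_inj) /=; apply: eq_big => [x|x _]; last by rewrite f_even.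
  rewrite /h opprK oppr_eq0 -leqNgt; case: (eqVneq x 0) => [->|x0] /=; first by rewrite oppr0 ltnn.
  rewrite leq_eqVlt; case: eqP => //= /val_inj/enum_rank_inj xx.
  by have := neqN x x0; rewrite -xx eqxx.
have [u [l ul] uE] : exists2 u, exists k, residue u k & Gam = - 1 + u *+ 2.
  (* -1 is the sum of the [e j] with j != 0, and [d j] is half of [eta j - (j != 0)]. *)
  pose d j : int := - ((eta j != 1) : nat)%:Z + (j == 0)%:R.
  have gaussE : gauss = -1 + (\sum_(j : 'F_p) (d j)%:~R * e j) *+ 2.
    have -> : -1 = \sum_(j : 'F_p) ((j != 0 : nat)%:Z)%:~R * e j.
      have := sum_echar; rewrite (bigD1 0) //= echar0 => /eqP; rewrite addrC addr_eq0 => /eqP <-.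
      rewrite [RHS](bigD1 (0 : 'F_p)) //= mul0r add0r.
      by apply: eq_bigr => j ->; rewrite mul1r.
    rewrite /gauss -sumrMnl -big_split /=; apply: eq_bigr => j _.
    rewrite -mulrnAl -mulrDl -[_%:~R *+ 2]rmorphMn -rmorphD /=; congr (_%:~R * _).
    rewrite /d; case: (eqVneq j 0) => [->|j0]; first by rewrite eta0.
    by case: (eta_sign j0) => ->.
  set r := \sum_(j : 'F_p) _ in gaussE.
  have rk : residue r (\sum_(j : 'F_p) d j)%:~R by exact: residue_sum_int.
  have podd : odd (p ^ n./2) by rewrite oddX p_odd orbT.
  exists (- (p ^ n./2)./2%:R + (p ^ n./2)%:R * r).
    exists (- (p ^ n./2)./2%:R + (p ^ n./2)%:R * (\sum_(j : 'F_p) d j)%:~R).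
    by apply: residueD; [apply: residueN | apply: residueM => //]; exact: residue_nat.
  rewrite /Gam gaussE -natrX; set P := (p ^ n./2)%N in podd *.
  have -> : P%:R = 1 + P./2%:R *+ 2 :> C.
    by rewrite -{1}(odd_double_half P) podd natrD -mul2n natrM mulr_natl.
  by ring.
have := Wf 0; rewrite qE uE => E; apply/esym.
apply: (@two_dvd_echar false (sf 0) 0 (g 0) ((-1) ^+ sf 0 * u * e (g 0) - q)); first exact: p_gt2.
  exists ((-1) ^+ sf 0 * l * 1 - k); apply: residueB => //.
  apply: residueM; last exact: residue_echar.
  apply: residueM => //.
  exact: residue_sign.
rewrite expr0 mul1r echar0; apply: (addIr (q *+ 2)); rewrite addrAC E; ring.
Qed.

(** For x orthogonal to B the sum of [sum_B] is the same at x as at 0, where it is [Gam], which is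
    nonzero; so x is in A and e(f x) = 1. *)
Lemma orthcB_sub : orthc B \subset A /\ {in orthc B, forall x, f x = 0}.
Proof.
have key x : x \in orthc B -> (x \in A) /\ f x = 0.
  move=> /in_orthcP xB; have := sum_B x; have := sum_B 0.
  rewrite (subspace0 Asub) f0 echar0 mulr1.
  have -> : \sum_(a in B) e (g a + dot a 0) = \sum_(a in B) e (g a + dot a x).
    by apply: eq_bigr => a /xB; rewrite dotC dot0r => ->.
  move=> -> /eqP; case: ifP => [_|_]; last by rewrite (negPf Gam_neq0).
  rewrite -{1}[Gam]mulr1 (inj_eq (mulfI Gam_neq0)) -echar0 (inj_eq echar_inj).
  by move/eqP <-.
by split=> [|x /key[]//]; apply/subsetP => x /key[].
Qed.

Lemma orthcA_sub : orthc A \subset B /\ {in orthc A, forall x, g x = 0}.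
Proof.
have sG0 : (-1) ^+ m * Gam != 0 by rewrite mulf_neq0 ?signr_eq0 ?Gam_neq0.
have key a : a \in orthc A -> (a \in B) /\ g a = 0.
  move=> /in_orthcP aA; have := sum_A a; have := sum_A 0.
  rewrite (subspace0 Bsub) dual0 echar0 mulr1.
  have -> : \sum_(x in A) e (f x + dot x 0) = \sum_(x in A) e (f x + dot x a).
    by apply: eq_bigr => x /aA; rewrite dotC dot0r => ->.
  move=> -> /eqP; case: ifP => [_|_]; last by rewrite (negPf sG0).
  rewrite -{1}[_ * Gam]mulr1 (inj_eq (mulfI sG0)) -echar0 (inj_eq echar_inj).
  by move/eqP <-.
by split=> [|x /key[]//]; apply/subsetP => x /key[].
Qed.

(** * Homogeneity, scaled sums and cardinals *)

Variable h : nat.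
Hypothesis (h_gt0 : (0 < h)%N) (h_coprime : coprime (h - 1) (p - 1)).
Hypothesis f_homog : forall (t : 'F_p) x, t != 0 -> f (t *: x) = t ^+ h * f x.

(** Conjugate the Walsh sum by t^h and substitute t x: t^h (f x - b.x) = f(t x) - (t^(h-1) b).(t x).
    Then compare exponents. *)
Lemma g_homog_pow (t : 'F_p) b : t != 0 -> g (t ^+ (h - 1) *: b) = t ^+ h * g b.
Proof.
move=> t0; have th0 : t ^+ h != 0 by rewrite expf_neq0.
have E1 : \sum_x e (f x - dot b x) = ((-1) ^+ sf b)%:~R * Gam * e (g b).
  by rewrite rmorph_sign; exact: Wf.
have := galois_gauss th0 E1.
have -> : \sum_x e (t ^+ h * (f x - dot b x)) = wtrans f (t ^+ (h - 1) *: b).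
  rewrite /wtrans [RHS](@reindex_inj _ _ _ V (fun x => t *: x) _ _ (scalerI t0)) /=.
  apply: eq_bigr => x _; rewrite f_homog // dotZl dotZr mulrBr mulrA -exprSr subn1.
  by rewrite (ltn_predK h_gt0).
rewrite Wf -rmorphM /=; have [s ->] : exists s : bool, (-1) ^+ sf b * eta (t ^+ h) = (-1) ^+ s :> int.
  by case: (eta_sign th0) => ->; [exists (sf b) | exists (~~ sf b)];
    rewrite ?mulr1 // signrN mulrN1.
by rewrite rmorph_sign => /sign_Gam_inj[].
Qed.

(** Bezout: with u (h - 1) = 1 modulo p - 1, the root is c^u. *)
Lemma Fp_pow_surj (c : 'F_p) : c != 0 -> exists2 t, t != 0 & t ^+ (h - 1) = c.
Proof.
(* h - 1 = 0 would make the gcd equal to p - 1 > 1. *)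
move=> c0; have h1 : (0 < h - 1)%N.
  rewrite lt0n; apply: contraTneq h_coprime => ->.
  by rewrite /coprime gcd0n; have := p_gt2; lia.
case: (egcdnP (p - 1) h1) => u v E _; move: E; rewrite (eqP h_coprime) => E.
exists (c ^+ u); first by rewrite expf_neq0.
by rewrite -exprM E exprD expr1 mulnC exprM subn1 Fp_fermat // expr1n mul1r.
Qed.

(** The factor is independent of b, so points with equal values of g keep equal values after
    scaling. *)
Lemma g_homog (c : 'F_p) : c != 0 -> exists u, forall b, g (c *: b) = u * g b.
Proof.
move=> /Fp_pow_surj[t t0 <-]; exists (t ^+ h) => b; exact: g_homog_pow.
Qed.

Lemma galois_sum_A (P : pred V) (c : 'F_p) a (t : int) : c != 0 ->
  \sum_(x | P x) e (f x + dot x (c^-1 *: a)) = t%:~R * Gam * e (g (c^-1 *: a)) ->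
  \sum_(x | P x) e (c * f x + dot x a) =
  t%:~R * (eta c)%:~R * Gam * e (c * g (c^-1 *: a)).
Proof.
move=> c0 /(galois_gauss c0) <-; apply: eq_bigr => x _.
by rewrite mulrDr dotZr mulrA mulfV // mul1r.
Qed.

(** Membership in B enters as an integer factor, so that one conjugation covers both cases of
    [sum_A]. *)
Lemma sum_A_scaled (c : 'F_p) a : c != 0 -> \sum_(x in A) e (c * f x + dot x a) =
  ((-1) ^+ m * (a \in B)%:R : int)%:~R * (eta c)%:~R * Gam * e (c * g (c^-1 *: a)).
Proof.
move=> c0; apply: galois_sum_A => //; rewrite sum_A (subspaceZ _ Bsub) ?invr_neq0 //.
by rewrite rmorphM rmorph_sign /=; case: (a \in B); rewrite ?mulr1 // mulr0 !mul0r.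
Qed.

Lemma sum_AC_scaled (c : 'F_p) a : c != 0 -> \sum_(x | x \notin A) e (c * f x + dot x a) =
  (- (-1) ^+ m * (a \notin B)%:R : int)%:~R * (eta c)%:~R * Gam * e (c * g (c^-1 *: a)).
Proof.
move=> c0; apply: galois_sum_A => //; rewrite sum_AC (subspaceZ _ Bsub) ?invr_neq0 //.
rewrite rmorphM rmorphN rmorph_sign /=.
by case: (a \in B); rewrite ?mulr1 ?mulNr // mulr0 !mul0r ?oppr0.
Qed.

Lemma sum_B_scaled (c : 'F_p) x : c != 0 -> \sum_(a in B) e (c * g a + dot a x) =
  ((x \in A)%:R : int)%:~R * (eta c)%:~R * Gam * e (c * f (c^-1 *: x)).
Proof.
move=> c0; have : \sum_(a in B) e (g a + dot a (c^-1 *: x)) =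
    ((x \in A)%:R : int)%:~R * Gam * e (f (c^-1 *: x)).
  by rewrite sum_B (subspaceZ _ Asub) ?invr_neq0 //; case: (x \in A); rewrite ?mul1r ?mul0r.
move/(galois_gauss c0) <-; apply: eq_bigr => a _.
by rewrite mulrDr dotZr mulrA mulfV // mul1r.
Qed.

Lemma sum_BC_scaled (c : 'F_p) x : c != 0 -> \sum_(a | a \notin B) e (c * g a + dot a x) =
  (- (x \notin A)%:R : int)%:~R * (eta c)%:~R * Gam * e (c * f (c^-1 *: x)).
Proof.
move=> c0; have : \sum_(a | a \notin B) e (g a + dot a (c^-1 *: x)) =
    (- (x \notin A)%:R : int)%:~R * Gam * e (f (c^-1 *: x)).
  rewrite sum_BC (subspaceZ _ Asub) ?invr_neq0 // rmorphN /=.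
  by case: (x \in A); rewrite ?mulN1r // oppr0 !mul0r.
move/(galois_gauss c0) <-; apply: eq_bigr => a _.
by rewrite mulrDr dotZr mulrA mulfV // mul1r.
Qed.

Lemma kind_convolution u v x y : kind A B f x = kind A B f y ->
    #|[set t | (kind A B f t == u) && (kind A B f (x - t) == v)]| =
    #|[set t | (kind A B f t == u) && (kind A B f (y - t) == v)]|.
Proof.
have [BA fB] := orthcB_sub; have [AB gA] := orthcA_sub.
apply: (convolution_classes (tau := kind B A g)).
- apply: kind_char_sum => // c a b c0 abB abg.
    by rewrite !sum_A_scaled // abB; have [w gw] := g_homog (invr_neq0 c0); rewrite !gw abg.
  by rewrite !sum_AC_scaled // abB; have [w gw] := g_homog (invr_neq0 c0); rewrite !gw abg.
- apply: kind_char_sum => // c a b c0 abA abf.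
    by rewrite !sum_B_scaled // abA !f_homog ?invr_neq0 // abf.
  by rewrite !sum_BC_scaled // abA !f_homog ?invr_neq0 // abf.
by move=> t; rewrite /kind oppr_eq0 orthcN f_even (subspaceN _ Asub).
Qed.

(** The level formula at the trivial character: c = 0 counts A, and the other c form a Gauss sum,
    with [Gam * gauss] equal to (-1)^m p^(n./2 + 1). *)
Lemma card_level_A j :
  (p * #|[set x in A | f x == j]|)%:Z =
  #|A|%:Z + (p ^ n./2.+1)%:Z * ((-1) ^+ m * eta j).
Proof.
apply: (@intr_inj C); have := level_char_sum (mem A) f j 0.
have -> : \sum_(x | (x \in A) && (f x == j)) e (dot x 0) = #|[set x in A | f x == j]|%:R.
  rewrite -sum1_card natr_sum; apply: eq_big => x; first by rewrite !inE.
  by rewrite dot0r echar0.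
rewrite -natrM => E; rewrite [LHS]E (bigD1 0) //= mul0r oppr0 echar0 mul1r.
under eq_bigr do rewrite mul0r add0r dot0r echar0.
rewrite sumr_const rmorphD /=; congr (_ + _).
transitivity (\sum_(c : 'F_p) (-1) ^+ m * Gam * ((eta c)%:~R * e (- j * c))).
  rewrite [RHS](bigD1 (0 : 'F_p)) //= eta0 mul0r mulr0 add0r; apply: eq_bigr => c c0.
  rewrite sum_A_scaled // (subspace0 Bsub) scaler0 dual0 mulr0 echar0 mulr1.
  by rewrite mulr1 rmorph_sign mulNr [j * c]mulrC; ring.
rewrite -mulr_sumr; have -> : \sum_(c : 'F_p) (eta c)%:~R * e (- j * c) = (eta (- j))%:~R * gauss.
  have [->|j0] := eqVneq j 0; last by rewrite gauss_scale ?oppr_eq0.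
  under eq_bigr do rewrite oppr0 mul0r echar0 mulr1.
  by rewrite -rmorph_sum sum_eta oppr0 eta0 mul0r.
have -> : eta (- j) = (-1) ^+ m * eta j by rewrite -[- j]mulN1r etaM etaN1.
have pE : ((p ^ n./2.+1)%N%:Z)%:~R = p%:R * p%:R ^+ n./2 :> C.
  by rewrite -natrX -natrM -expnS.
rewrite [in RHS]rmorphM /= pE !rmorphM !rmorph_sign /= /Gam.
have := sqrr_sign C m; have := gauss_sqr; move: ((-1) ^+ m) => s gg ss.
transitivity (s ^+ 2 * p%:R ^+ n./2 * (eta j)%:~R * gauss ^+ 2); first by ring.
by rewrite gg ss; ring.
Qed.

(** As 0 is in B, the terms with c != 0 vanish: f is equidistributed off A. *)
Lemma card_level_AC j : (p * #|[set x in ~: A | f x == j]| = p ^ n - #|A|)%N.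
Proof.
apply/eqP; rewrite -(eqr_nat C); have := level_char_sum (fun x => x \notin A) f j 0.
have -> : \sum_(x | (x \notin A) && (f x == j)) e (dot x 0) = #|[set x in ~: A | f x == j]|%:R.
  rewrite -sum1_card natr_sum; apply: eq_big => x; first by rewrite !inE.
  by rewrite dot0r echar0.
rewrite -natrM => ->; rewrite (bigD1 0) //= mul0r oppr0 echar0 mul1r.
under eq_bigr do rewrite mul0r add0r dot0r echar0.
have -> : \sum_(x | x \notin A) (1 : C) = #|~: A|%:R.
  by rewrite -sum1_card natr_sum; apply: eq_bigl => x; rewrite in_setC.
rewrite big1 ?addr0 => [|c c0]; last first.
  by rewrite sum_AC_scaled // (subspace0 Bsub) mulr0 !mul0r mulr0.
by rewrite -card_rVp -(cardsC A) addKn.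
Qed.

End DualPair.

End Fourier.

End CyclotomicIntegers.

(** * From convolution classes to schemes *)

Section Schemes.

Set Implicit Arguments.
Unset Strict Implicit.

Lemma fiber_partition (T K : finType) (phi : T -> K) (KS : {set K}) :
  (forall x, phi x \in KS) -> (forall k, k \in KS -> exists x, phi x = k) ->
  partition [set [set x | phi x == k] | k in KS] [set: T].
Proof.
move=> phiKS surj; apply/and3P; split.
- apply/eqP/setP => x; rewrite inE; apply/bigcupP; exists [set y | phi y == phi x].
    by apply/imsetP; exists (phi x).
  by rewrite inE.
- apply/trivIsetP => _ _ /imsetP[k _ ->] /imsetP[l _ ->] kl.
  rewrite -setI_eq0; apply/eqP/setP => x; rewrite !inE; apply/negP => /andP[/eqP xk /eqP xl].
  by move: kl; rewrite -xk -xl eqxx.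
- apply/imsetP => -[k /surj[x xk] /setP /(_ x)]; by rewrite !inE xk eqxx.
Qed.

Variables (p n : nat).
Local Notation V := 'rV['F_p]_n.

Lemma classes_scheme (K : finType) (kappa : V -> K) (KS : {set K}) (k0 : K) d :
  (forall x, kappa x \in KS) -> (forall k, k \in KS -> exists x, kappa x = k) ->
  (forall x, (kappa x == k0) = (x == 0)) -> (forall x, kappa (- x) = kappa x) ->
  (forall u v x y, kappa x = kappa y ->
    #|[set t | (kappa t == u) && (kappa (x - t) == v)]| =
    #|[set t | (kappa t == u) && (kappa (y - t) == v)]|) ->
  #|KS| = d.+1 ->
  let U := [set [set x | kappa x == k] | k in KS] in
  partition U [set: V] /\ induces_symmetric_scheme d U.
Proof.
move=> kKS surj kz kN conv cardKS U; split; first exact: fiber_partition.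
have k0S : k0 \in KS by have /eqP <- : kappa 0 == k0 by rewrite kz.
(* [k0] comes first because the class of index 0 has to be {0}. *)
pose s := k0 :: enum (KS :\ k0).
have szs : size s = d.+1 by rewrite /= -cardE -cardKS (cardsD1 k0 KS) k0S.
have us : uniq s by rewrite /= mem_enum !inE eqxx enum_uniq.
have memS k : (k \in s) = (k \in KS).
  by rewrite inE mem_enum !inE; case: eqP => [->|].
pose q (i : 'I_d.+1) := nth k0 s i.
have qS i : q i \in KS by rewrite -memS mem_nth // szs.
have q_inj : injective q.
  by move=> i j /eqP; rewrite nth_uniq ?szs // => /eqP/val_inj.
have q_surj k : k \in KS -> exists i, q i = k.
  move=> kS; have kl : (index k s < d.+1)%N by rewrite -szs index_mem memS.
  by exists (Ordinal kl); rewrite /q /= nth_index // memS.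
have imq (T : finType) (G : K -> {set T}) : [set G (q i) | i : 'I_d.+1] = [set G k | k in KS].
  apply/setP => W; apply/imsetP/imsetP => [[i _ ->]|[k /q_surj[i <-] ->]].
    by exists (q i).
  by exists i.
pose u i := [set x : V | kappa x == q i].
have u_inj : injective u.
  move=> i j /setP uij; have [x xi] := surj _ (qS i).
  by move: (uij x); rewrite !inE xi eqxx => /esym/eqP/q_inj.
have diff_surj k : k \in KS -> exists ab : V * V, kappa (ab.1 - ab.2) = k.
  by case/surj => x xk; exists (x, 0); rewrite subr0.
exists u; split=> //.
- by rewrite (imq _ (fun k => [set x | kappa x == k])).
- by apply/setP => x; rewrite !inE kz.
have symm i : transp [set ab : V * V | ab.1 - ab.2 \in u i] =
    [set ab : V * V | ab.1 - ab.2 \in u i].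
  by apply/setP => -[a b]; rewrite !inE /= -(kN (b - a)) opprB.
split=> //; split.
- by apply/card_gt0P; exists 0.
- split.
    move=> i j /setP Rij; apply: u_inj; apply/setP => x.
    by have := Rij (x, 0); rewrite !inE subr0.
  rewrite (_ : [set _ | i : 'I_d.+1] =
      [set [set ab : V * V | kappa (ab.1 - ab.2) == k] | k in KS]).
    by apply: fiber_partition.
  have uE i : [set ab : V * V | ab.1 - ab.2 \in u i] =
      [set ab : V * V | kappa (ab.1 - ab.2) == q i] by apply/setP => ab; rewrite !inE.
  apply/setP => W; apply/imsetP/imsetP => [[i _ ->]|[k /q_surj[i <-] ->]].
    by exists (q i); rewrite ?qS ?uE.
  by exists i; rewrite ?uE.
- by apply/setP => -[a b]; rewrite !inE /= kz subr_eq0.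
- by move=> i; exists i; rewrite symm.
move=> i j l; have [x0 x0l] := surj _ (qS l).
(* Any x0 in the class gives the intersection number; t -> x - t turns the count for (x, y) into a
   convolution at x - y. *)
exists #|[set t | (kappa t == q i) && (kappa (x0 - t) == q j)]| => x y.
rewrite !inE /= => /eqP xyl; rewrite -(conv _ _ (x - y)) ?xyl ?x0l //.
rewrite -!sum1_card (@reindex_inj _ _ _ V (fun t => x - t) _ _ (@subrI _ x)) /=.
apply: eq_bigl => t; rewrite !inE /=; congr (_ && _); first by rewrite subKr.
by rewrite addrAC.
Qed.

End Schemes.

(** * The partitions U10 to U13 *)

Section ComplexRoot.

Set Implicit Arguments.
Unset Strict Implicit.

Variables (R : realType) (p : nat) (p_prime : prime p) (p_odd : odd p).

Local Notation m := p./2.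

(** * The root of unity and its Gauss sum in [R[i]] *)

Definition cis (t : R) : R[i] := (cos t +i* sin t)%C.

Lemma cisD s t : cis (s + t) = cis s * cis t.
Proof. by rewrite /cis cosD sinD; apply/eqP; rewrite eq_complex /= [sin s * _ + _]addrC !eqxx. Qed.

Lemma cisX t k : cis t ^+ k = cis (t *+ k).
Proof.
elim: k => [|k IHk]; first by rewrite expr0 mulr0n /cis cos0 sin0.
by rewrite exprS IHk mulrS cisD.
Qed.

Lemma cisV t : (cis t)^-1 = cis (- t).
Proof.
have c1 : cis t * cis (- t) = 1 by rewrite -cisD subrr /cis cos0 sin0.
by apply: (mulfI (x := cis t)); rewrite ?c1 ?mulfV //;
  apply: contra_eq_neq c1 => ->; rewrite mul0r eq_sym oner_eq0.
Qed.

(** The square root of [xi] of angle pi / p: the sines of its powers below p are positive, which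
    settles the sign of the Gauss sum. *)
Let w := cis (pi / p%:R).

Lemma p_neq0 : (p%:R : R) != 0.
Proof. by rewrite pnatr_eq0 -lt0n prime_gt0. Qed.

Lemma half_root_sqr : w ^+ 2 = xi R p.
Proof. by rewrite cisX -[(pi / _) *+ _]mulr_natl mulrA. Qed.

Lemma half_root_pow : w ^+ p = -1.
Proof.
rewrite cisX -[(pi / _) *+ _]mulr_natr divfK ?p_neq0 // /cis cospi sinpi.
by apply/eqP; rewrite eq_complex /= oppr0 !eqxx.
Qed.

Lemma sin_arg_gt0 k : (0 < k < p)%N -> 0 < sin (pi / p%:R *+ k : R).
Proof.
case/andP=> k0 kp; have pp := pi_gt0 R.
have p0 : 0 < (p%:R : R) by rewrite ltr0n prime_gt0.
apply: sin_gt0_pi; rewrite -mulr_natr -mulrA mulr_gt0 //=; last first.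
  by apply: mulr_gt0; rewrite ?invr_gt0 // ltr0n.
by rewrite gtr_pMr // mulrC ltr_pdivrMr // mul1r ltr_nat.
Qed.

(** The order divides the prime p. Order 1 would force w to be 1 or -1, against sin(pi / p) > 0. *)
Lemma xi_prim : p.-primitive_root (xi R p).
Proof.
have xip : xi R p ^+ p = 1 by rewrite -half_root_sqr exprAC half_root_pow sqrrN expr1n.
have [k kprim kp] := prim_order_exists (prime_gt0 p_prime) xip.
have /(primeP p_prime).2 /orP[/eqP k1|/eqP kE] := kp; last by rewrite kE in kprim.
have : xi R p = 1 by have := prim_expr_order kprim; rewrite k1 expr1.
rewrite -half_root_sqr => /eqP; rewrite sqrf_eq1 => ww.
have s0 : 0 < sin (pi / p%:R : R).
  by have := @sin_arg_gt0 1; rewrite mulr1n; apply; rewrite prime_gt1.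
have s00 : sin (pi / p%:R : R) = 0.
  by case/orP: ww => /eqP/(congr1 (@complex.Im R)) /=; rewrite ?oppr0.
by move: s0; rewrite s00 ltxx.
Qed.

Lemma sine_prodE : exists2 rho : R, 0 < rho &
  sine_prod p w = 'i%C ^+ m * (rho%:C)%C.
Proof.
exists (\prod_(1 <= k < m.+1) (2 * sin (pi / p%:R *+ k))).
  rewrite big_nat; apply: prodr_gt0 => k /andP[k0 km].
  by rewrite mulr_gt0 // sin_arg_gt0 // k0 /=; have := p_halfE p_odd; lia.
rewrite rmorph_prod /= -[X in _ ^+ X](subn1 m.+1) -prodr_const_nat -big_split /=.
apply: eq_bigr => k _; rewrite -exprVn cisV !cisX mulNrn /cis cosN sinN.
by apply/eqP; rewrite eq_complex /=; apply/andP; split; apply/eqP; ring.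
Qed.

Lemma triangular k : (2 * \sum_(1 <= i < k.+1) i = k * k.+1)%N.
Proof.
elim: k => [|k IHk]; first by rewrite big_geq.
by rewrite big_nat_recr //= mulnDr IHk; lia.
Qed.

(** For odd n, p^n = p modulo 4, and p = 2m + 1 is 1 modulo 4 exactly when m is even. *)
Lemma mu_odd n : odd n -> mu R p n = 'i%C ^+ odd m.
Proof.
move=> n_odd; rewrite /mu; have -> : (p ^ n %% 4 == 1)%N = ~~ odd m.
  have p2 : (p ^ 2 %% 4 = 1)%N.
    rewrite (p_halfE p_odd) -addn1 sqrnD -mul2n; set q := m.
    by rewrite (_ : (_ + _ = 4 * (q ^ 2 + q) + 1)%N) ?modnMDl // 1?mulnC ?modnMDl //; lia.
  rewrite -{1}(odd_double_half n) n_odd -mul2n expnD expnM expn1 -modnMmr -modnXm p2 exp1n.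
  rewrite [(1 %% 4)%N]/= muln1; have := p_halfE p_odd; have := odd_double_half m.
  by case: (odd m) => /=; lia.
by case: (odd m).
Qed.

(** Writing -1 as i^2, the total exponent of i is 4m + m^2, congruent to [odd m] modulo 4. The
    positive factor rho is then found from the square of the Gauss sum. *)
Lemma gaussE : gauss p (xi R p) = 'i%C ^+ odd m * sqrtC p%:R.
Proof.
have [rho rho0 sE] := sine_prodE.
have g2 := gauss_sqr p_prime p_odd xi_prim.
have gs := gauss_sine_prod p_prime p_odd xi_prim half_root_sqr half_root_pow.
have gE : gauss p (xi R p) = 'i%C ^+ odd m * (rho%:C)%C.
  rewrite gs sE mulrA; congr (_ * _).
  have i2 : (-1 : R[i]) = 'i%C ^+ 2 by rewrite sqr_i.
  rewrite i2 -exprM -exprD mulnDr triangular.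
  have -> : (2 * m + m * m.+1 + m = 4 * m + m * m)%N by lia.
  have i4 : 'i%C ^+ 4 = 1 :> R[i] by rewrite (exprM _ 2 2) sqr_i sqrrN expr1n.
  rewrite exprD exprM i4 expr1n mul1r -{1 2}(odd_double_half m).
  have -> : ((odd m + m./2.*2) * (odd m + m./2.*2) = odd m + 4 * (odd m * m./2 + m./2 * m./2))%N.
    by case: (odd m); lia.
  by rewrite exprD exprM i4 expr1n mulr1.
have r0 : 0 <= (rho%:C)%C by rewrite ler0c ltW.
suff : (rho%:C)%C ^+ 2 = p%:R by move=> <-; rewrite sqrCK // gE.
move: g2; rewrite gE exprMn -exprM mulnC exprM sqr_i -[in RHS]signr_odd.
by move/(mulfI _); apply; rewrite signr_eq0.
Qed.

Lemma mu_half_powE n : odd n -> mu R p n * half_pow R p n = Gam p (xi R p) n.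
Proof.
move=> n_odd; rewrite mu_odd // /half_pow /Gam gaussE mulrCA; congr (_ * _).
have -> : (p%:R : R[i]) ^+ n = (p%:R ^+ n./2 * sqrtC p%:R) ^+ 2.
  rewrite exprMn sqrtCK -exprM -exprSr muln2 -[in LHS](odd_double_half n) n_odd.
  by [].
by rewrite sqrCK // mulr_ge0 ?sqrtC_ge0 ?exprn_ge0 ?ler0n.
Qed.

(** * Walsh values and the classes of the partitions *)

Variables (n : nat) (n_odd : odd n).
Local Notation V := 'rV['F_p]_n.

Lemma walshE (f : V -> 'F_p) a : walsh R f a = wtrans (xi R p) f a.
Proof. by []. Qed.

Lemma bent_sqr (f : V -> 'F_p) a : bent R f ->
  wtrans (xi R p) f a * (wtrans (xi R p) f a)^*%R = p%:R ^+ n.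
Proof. by move=> /(_ a) fa; rewrite -normCK -walshE fa /half_pow sqrtCK. Qed.

(** [bent_value] shows that the [pick] in [dual] never falls back to its default. *)
Lemma walsh_dual (f : V -> 'F_p) a : bent R f ->
  walsh R f a = (-1) ^+ (a \notin Bplus R f) * Gam p (xi R p) n * echar (xi R p) (dual R f a).
Proof.
move=> fb; have [s [k E]] := bent_value p_prime p_odd xi_prim n_odd (bent_sqr a fb).
rewrite /Bplus inE; rewrite /dual; case: pickP => [j|none]; last first.
  have := none k; rewrite walshE E mu_half_powE // -/(echar _ _).
  by case: s E => _; rewrite ?expr0 ?expr1 ?mulN1r ?mul1r ?mulNr eqxx ?orbT.
rewrite mu_half_powE // -/(echar _ j) /= => /orP[/eqP ->|/eqP ->].
  by rewrite eqxx mul1r.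
case: eqP => [->|_]; first by rewrite mul1r.
by rewrite expr1 mulN1r mulNr.
Qed.

Lemma BminusE (f : V -> 'F_p) : bent R f -> Bminus R f = ~: Bplus R f.
Proof.
move=> fb; apply/setP => a; rewrite in_setC inE walsh_dual // mu_half_powE // -/(echar _ _).
have G0 : Gam p (xi R p) n * echar (xi R p) (dual R f a) != 0.
  by rewrite mulf_neq0 ?Gam_neq0 ?echar_neq0 //; exact: xi_prim.
case: (a \in Bplus R f) => /=; last by rewrite expr1 mulN1r mulNr eqxx.
by rewrite expr0 mul1r -subr_eq0 opprK -mulr2n mulrn_eq0 (negPf G0).
Qed.

Lemma card_subspace (S : {set V}) r (U : {vspace V}) :
  S = [set x | x \in U] -> \dim U = r -> #|S| = (p ^ r)%N.
Proof.
move=> -> <-; rewrite cardsE; have := @card_vspace 'F_p _ _ U.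
by rewrite card_Fp.
Qed.

(** The values of [kind] that are attained, Q being the set of j whose class inside A is
    nonempty. *)
Definition kind_values (Q : {set 'F_p}) : {set bool + bool * 'F_p} :=
  [set k | match k with inl _ => true | inr (true, j) => j \in Q | _ => true end].

Lemma card_kind_values Q : #|kind_values Q| = (2 + (#|Q| + p))%N.
Proof.
rewrite -sum1_card; under eq_bigl do rewrite inE.
rewrite big_sumType /= sum1_card card_bool; congr (_ + _)%N.
rewrite (bigID (fun k : bool * 'F_p => k.1)) /=; congr (_ + _)%N.
  rewrite (reindex_onto (fun j => (true, j)) snd) /= => [|[[] j] /andP[]] //.
  by rewrite -[RHS]sum1_card; apply: eq_bigl => j; rewrite eqxx !andbT.
rewrite (reindex_onto (fun j => (false, j)) snd) /= => [|[[] j] /andP[]] //.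
rewrite -[RHS](card_Fp p_prime) -sum1_card; apply: eq_bigl => j.
by rewrite eqxx.
Qed.

Variables (f : V -> 'F_p) (r : nat).
Hypotheses (f_bent : bent R f) (g_bent : bent R (dual R f)) (f0 : f 0 = 0).
Variable h : nat.
Hypothesis (h_gt0 : (0 < h)%N) (h_coprime : gcdn (h - 1) (p - 1) = 1%N).
Hypothesis f_homog : forall (t : 'F_p) x, t != 0 -> f (t *: x) = t ^+ h * f x.

Let A := Bplus R (dual R f).
(** [odd m] means p = 3 modulo 4. *)
Let B := if odd m then Bminus R f else Bplus R f.

Hypotheses (A_sub : is_nondegenerate_subspace r A).
Hypotheses (B_sub : is_nondegenerate_subspace r B).

Let z_prim := xi_prim.

(** h - 1 is coprime to the even number p - 1; evenness of h makes f even. *)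
Lemma h_even : odd h = false.
Proof.
apply/negP => h_odd; have : (2 %| gcdn (h - 1) (p - 1))%N.
  rewrite dvdn_gcd !dvdn2; move: h_odd p_odd h_gt0; lia.
by rewrite h_coprime.
Qed.

Lemma homog_even x : f (- x) = f x.
Proof.
rewrite -scaleN1r f_homog ?oppr_eq0 ?oner_eq0 // -signr_odd h_even.
by rewrite expr0 mul1r.
Qed.

Lemma A_subspace : subspace A.
Proof. by case: A_sub => U [eqA _ _]; exists U. Qed.

Lemma B_subspace : subspace B.
Proof. by case: B_sub => U [eqB _ _]; exists U. Qed.

Lemma card_A : #|A| = (p ^ r)%N.
Proof. by case: A_sub => U [eqA dU _]; exact: card_subspace eqA dU. Qed.

Lemma card_B : #|B| = (p ^ r)%N.
Proof. by case: B_sub => U [eqB dU _]; exact: card_subspace eqB dU. Qed.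

Let sf a := a \notin Bplus R f.
Let sg x := x \notin Bplus R (dual R f).

Lemma dual_sign_set : [set x | ~~ sg x] = A.
Proof. by apply/setP => x; rewrite in_set negbK. Qed.

Lemma sign_set : [set a | sf a == odd m] = B.
Proof.
apply/setP => a; rewrite in_set /B BminusE // /sf.
by case: (odd m); rewrite ?in_setC; case: (a \in _).
Qed.

Lemma walsh_f a : wtrans (xi R p) f a =
  (-1) ^+ sf a * Gam p (xi R p) n * echar (xi R p) (dual R f a).
Proof. by rewrite -walshE walsh_dual. Qed.

Lemma walsh_dual_f x : wtrans (xi R p) (dual R f) x =
  (-1) ^+ sg x * Gam p (xi R p) n * echar (xi R p) (dual R (dual R f) x).
Proof. by rewrite -walshE walsh_dual. Qed.

Let kappa := kind A B f.

Lemma subspaces : subspace [set x | ~~ sg x] /\ subspace [set a | sf a == odd m].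
Proof. by rewrite dual_sign_set sign_set; split; [exact: A_subspace | exact: B_subspace]. Qed.

Lemma kappa_convolution u v x y : kappa x = kappa y ->
    #|[set t | (kappa t == u) && (kappa (x - t) == v)]| =
    #|[set t | (kappa t == u) && (kappa (y - t) == v)]|.
Proof.
have [As Bs] := subspaces; rewrite /kappa -dual_sign_set -sign_set.
apply: (kind_convolution p_prime p_odd z_prim n_odd walsh_f walsh_dual_f As Bs homog_even f0 h_gt0 _ f_homog).
by rewrite /coprime h_coprime.
Qed.

Lemma card_cset j : (p * #|cset R f j|)%:Z =
  (p ^ r)%:Z + (p ^ n./2.+1)%:Z * ((-1) ^+ m * eta j).
Proof.
have [As Bs] := subspaces.
have := card_level_A p_prime p_odd z_prim n_odd walsh_f walsh_dual_f As Bs homog_even f0 j.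
by rewrite dual_sign_set card_A.
Qed.

Lemma card_dset j : (p * #|dset R f j|)%N = (p ^ n - p ^ r)%N.
Proof.
have [As Bs] := subspaces.
have := card_level_AC p_prime p_odd z_prim n_odd walsh_f walsh_dual_f As Bs homog_even j.
by rewrite dual_sign_set card_A /dset BminusE.
Qed.

Lemma orthcB_subset : orthc B \subset A /\ {in orthc B, forall x, f x = 0}.
Proof.
have [As Bs] := subspaces.
by have := orthcB_sub p_prime p_odd z_prim n_odd walsh_f walsh_dual_f As f0; rewrite dual_sign_set sign_set.
Qed.

Lemma card_orthcB : (p ^ r * #|orthc B|)%N = (p ^ n)%N.
Proof. by have := card_orthc p_prime z_prim B_subspace; rewrite card_B. Qed.

Lemma kappa_fiber_inl b : [set x | kappa x == inl b] =
  if b then [set 0] else orthc B :\ 0.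
Proof.
apply/setP => x; rewrite in_set /kappa /kind; case: b; rewrite ?in_set1 ?in_setD1.
  by case: (eqVneq x 0) => // _; case: ifP.
by case: (eqVneq x 0) => //= _; case: ifP.
Qed.

Lemma in_cset x j : (x \in cset R f j) = (x \in A) && (f x == j).
Proof. by rewrite /cset in_set. Qed.

Lemma kappa_fiber_c j : [set x | kappa x == inr (true, j)] = cset R f j :\: orthc B.
Proof.
apply/setP => x; rewrite in_set in_setD /kappa /kind.
case: (eqVneq x 0) => [->|_]; first by rewrite orthc0.
case: ifP => //= _; rewrite in_cset.
by apply/eqP/andP => [[-> ->]|[-> /eqP ->]].
Qed.

Lemma kappa_fiber_d j : [set x | kappa x == inr (false, j)] = dset R f j.
Proof.
have [/subsetP BA _] := orthcB_subset.
apply/setP => x; rewrite in_set /dset BminusE // [in RHS]in_set in_setC -/A /kappa /kind.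
case: (eqVneq x 0) => [->|_]; first by rewrite (subspace0 A_subspace).
case: ifP => [/BA -> //|_].
by apply/eqP/andP => [[/negbT -> ->]|[/negPf -> /eqP ->]].
Qed.

(** Common form of the four partitions. [r < n] makes [orthc B :\ 0] and every [dset] nonempty. *)
Lemma kappa_scheme (Q : {set 'F_p}) (U : {set {set V}}) d : (r < n)%N ->
  (forall j, (j \in Q) = (cset R f j :\: orthc B != set0)) ->
  (2 + (#|Q| + p))%N = d.+1 ->
  U = [set [set 0]; orthc B :\ 0] :|: [set cset R f j :\: orthc B | j in Q]
        :|: [set dset R f j | j : 'F_p] ->
  partition U [set: V] /\ induces_symmetric_scheme d U.
Proof.
move=> rn QE cardQ UE.
have kQ x : kappa x \in kind_values Q.
  rewrite in_set; case E : (kappa x) => [b|[[] j]] //.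
  by rewrite QE -kappa_fiber_c; apply/set0Pn; exists x; rewrite in_set E.
have ex (k : bool + bool * 'F_p) S : [set x | kappa x == k] = S -> S != set0 ->
    exists x, kappa x = k.
  by move=> <- /set0Pn[x]; rewrite in_set => /eqP; exists x.
have p1 := prime_gt1 p_prime.
have surj k : k \in kind_values Q -> exists x, kappa x = k.
  rewrite in_set; case: k => [[]|[[] j]] kK.
  - by apply: (ex _ _ (kappa_fiber_inl true)); apply/set0Pn; exists 0; rewrite in_set1.
  - apply: (ex _ _ (kappa_fiber_inl false)) => /=.
    rewrite -card_gt0 -(ltn_add2l 1) addn0 -[X in (X + _)%N](_ : (0 \in orthc B : nat) = 1%N).
      rewrite -cardsD1 -(ltn_pmul2l (_ : 0 < p ^ r)%N) ?expn_gt0 ?prime_gt0 //.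
      by rewrite card_orthcB muln1 ltn_exp2l.
    by rewrite orthc0.
  - by apply: (ex _ _ (kappa_fiber_c j)); rewrite -QE.
  - apply: (ex _ _ (kappa_fiber_d j)); rewrite -card_gt0 -(ltn_pmul2l (prime_gt0 p_prime)).
    by rewrite card_dset muln0 subn_gt0 ltn_exp2l.
have -> : U = [set [set x | kappa x == k] | k in kind_values Q].
  rewrite UE; apply/setP => W; apply/idP/imsetP.
    case/setUP => [/setUP[/set2P[]|/imsetP[j jQ]]|/imsetP[j _]] ->.
    - by exists (inl true); rewrite ?in_set // kappa_fiber_inl.
    - by exists (inl false); rewrite ?in_set // kappa_fiber_inl.
    - by exists (inr (true, j)); rewrite ?in_set // kappa_fiber_c.
    - by exists (inr (false, j)); rewrite ?in_set // kappa_fiber_d.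
  case=> -[[]|[[] j]]; rewrite in_set => kK ->;
    rewrite ?kappa_fiber_inl ?kappa_fiber_c ?kappa_fiber_d.
  - by rewrite !in_setU in_set1 eqxx.
  - by rewrite !in_setU !in_set1 eqxx orbT.
  - by apply/setUP; left; apply/setUP; right; apply/imsetP; exists j.
  - by apply/setUP; right; apply/imsetP; exists j.
apply: (classes_scheme (k0 := inl true) kQ surj); last by rewrite card_kind_values.
- by move=> x; rewrite /kappa kind0.
- by move=> x; rewrite /kappa /kind oppr_eq0 orthcN homog_even (subspaceN _ A_subspace).
- exact: kappa_convolution.
Qed.

(** [orthc B] lies in c_0, and the cardinals p^(n-r) and p^(r-1) agree since 2r = n + 1. *)
Lemma cset_orthc0 : r = ((n + 1) %/ 2)%N -> cset R f 0 = orthc B.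
Proof.
move=> rE; have [/subsetP BA fB] := orthcB_subset.
have rn : r = n./2.+1 by move: rE; have := odd_double_half n; rewrite n_odd; lia.
apply/esym/eqP; rewrite eqEcard; apply/andP; split.
  by apply/subsetP => x xB; rewrite in_set BA // fB /=.
have := card_cset 0; rewrite eta0 !mulr0 addr0 => -[c0].
rewrite -(leq_pmul2l (_ : 0 < p ^ r)%N) ?expn_gt0 ?prime_gt0 // card_orthcB.
rewrite -(leq_pmul2l (prime_gt0 p_prime)) mulnCA c0 -expnD -expnS leq_exp2l ?prime_gt1 //.
by have := odd_double_half n; rewrite n_odd; lia.
Qed.

(** Here p |c_j| = p^r (1 + (-1)^m eta j), so for j != 0 the class is empty exactly when the sign is
    -1; for j = 0 nothing is left outside [orthc B]. *)
Lemma cset_half_orthc j : r = ((n + 1) %/ 2)%N ->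
  (cset R f j :\: orthc B != set0) = ((-1) ^+ m * eta j == 1).
Proof.
move=> rE; have rn : r = n./2.+1 by move: rE; have := odd_double_half n; rewrite n_odd; lia.
have [_ fB] := orthcB_subset.
have [->|j0] := eqVneq j 0; first by rewrite cset_orthc0 // setDv eqxx eta0 mulr0.
have -> : cset R f j :\: orthc B = cset R f j.
  apply/setP => x; rewrite in_setD andbC; case xc : (x \in cset R f j) => //=.
  apply/negP => /fB fx; move: xc; rewrite in_set fx => /andP[_ /eqP j00].
  by rewrite -j00 eqxx in j0.
rewrite -card_gt0 -(ltn_pmul2l (prime_gt0 p_prime)) muln0 -ltz_nat card_cset rn.
have pp : (0 < (p ^ n./2.+1)%N%:Z) by rewrite ltz_nat expn_gt0 prime_gt0.
rewrite -[X in X + _]mulr1 -mulrDr pmulr_rgt0 //.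
have [s ->] : exists s : bool, (-1) ^+ m * eta j = (-1) ^+ s :> int.
  by case: (eta_sign j0) => ->; [exists (odd m) | exists (~~ odd m)];
    rewrite ?mulr1 ?signr_odd // signrN mulrN1 signr_odd.
by case: s.
Qed.

(** For j != 0, p^r exceeds the Gauss sum term p^(n./2 + 1); for j = 0, p^(r-1) exceeds p^(n-r). *)
Lemma cset_big_orthc j : ((n + 1) %/ 2 < r)%N -> cset R f j :\: orthc B != set0.
Proof.
move=> rE; have rn : (n./2.+1 < r)%N by move: rE; have := odd_double_half n; rewrite n_odd; lia.
have [/subsetP BA fB] := orthcB_subset; have p1 := prime_gt1 p_prime.
rewrite -card_gt0 cardsD subn_gt0.
have [->|j0] := eqVneq j 0.
  apply: leq_ltn_trans (subset_leq_card (subsetIr _ _)) _.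
  have := card_cset 0; rewrite eta0 !mulr0 addr0 => -[c0].
  rewrite -(ltn_pmul2l (_ : 0 < p ^ r)%N) ?expn_gt0 ?prime_gt0 // card_orthcB.
  rewrite -(ltn_pmul2l (prime_gt0 p_prime)) mulnCA c0 -expnD -expnS ltn_exp2l //.
  by have := odd_double_half n; rewrite n_odd; lia.
have -> : cset R f j :&: orthc B = set0.
  apply/setP => x; rewrite in_setI in_set0; apply/negP => /andP[+ /fB fx].
  by rewrite in_set fx => /andP[_ /eqP j00]; rewrite -j00 eqxx in j0.
rewrite cards0 -(ltn_pmul2l (prime_gt0 p_prime)) muln0 -ltz_nat card_cset.
have pp : ((p ^ n./2.+1)%N%:Z < (p ^ r)%N%:Z) by rewrite ltz_nat ltn_exp2l.
have [s ->] : exists s : bool, (-1) ^+ m * eta j = (-1) ^+ s :> int.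
  by case: (eta_sign j0) => ->; [exists (odd m) | exists (~~ odd m)];
    rewrite ?mulr1 ?signr_odd // signrN mulrN1 signr_odd.
case: s; rewrite ?mulrN1 ?mulr1 ?subr_gt0 //.
by rewrite addr_gt0 // ltz_nat expn_gt0 prime_gt0.
Qed.

Lemma half_scheme (Q : {set 'F_p}) : (3 <= n)%N -> r = ((n + 1) %/ 2)%N ->
  Q = [set j | (-1) ^+ m * eta j == 1] ->
  let U := [set [set 0]; cset R f 0 :\ 0] :|: [set cset R f j | j in Q]
        :|: [set dset R f j | j : 'F_p] in
  partition U [set: V] /\ induces_symmetric_scheme ((3 * p + 1) %/ 2) U.
Proof.
move=> n3 rE QE U; have [_ fB] := orthcB_subset.
have n2 := odd_double_half n; rewrite n_odd in n2.
apply: (kappa_scheme (Q := Q)); first by rewrite rE; lia.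
- by move=> j; rewrite QE in_set cset_half_orthc.
(* Q is the squares or the nonsquares, so there are 2 + m + p = (3p + 1)/2 + 1 classes. *)
- have -> : #|Q| = m.
    rewrite QE; have [c1 c2] := card_eta_sign p_prime p_odd.
    rewrite -signr_odd; case: (odd m).
      by rewrite -[RHS]c2; apply: eq_card => j; rewrite !in_set mulN1r eqr_oppLR.
    by rewrite -[RHS]c1; apply: eq_card => j; rewrite !in_set mul1r.
  by have := p_halfE p_odd; lia.
rewrite /U (cset_orthc0 rE); congr (_ :|: _ :|: _); apply: eq_in_imset => j.
rewrite QE in_set => ej; apply/setP => x; rewrite in_setD.
case xB : (x \in orthc B) => //=; rewrite in_set (fB _ xB).
by apply/negP => /andP[_ /eqP j0]; rewrite -j0 eta0 mulr0 in ej.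
Qed.

(** Every j contributes a class inside A, the one for j = 0 being c_0 without [orthc B]; this makes
    2 + p + p classes. *)
Lemma big_scheme : ((n + 1) %/ 2 < r <= n - 1)%N ->
  let U := [set [set 0]; orthc B :\ 0; cset R f 0 :\: orthc B]
        :|: [set cset R f j | j in [set~ (0 : 'F_p)]] :|: [set dset R f j | j : 'F_p] in
  partition U [set: V] /\ induces_symmetric_scheme (2 * p + 1) U.
Proof.
case/andP=> r1 r2 U; have [_ fB] := orthcB_subset.
apply: (kappa_scheme (Q := [set: 'F_p])).
- by lia.
- by move=> j; rewrite in_setT cset_big_orthc.
- by rewrite cardsT card_Fp //; lia.
rewrite /U; congr (_ :|: _).
have cE j : j != 0 -> cset R f j :\: orthc B = cset R f j.
  move=> j0; apply/setP => x; rewrite in_setD; case xB : (x \in orthc B) => //=.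
  by apply/esym; rewrite in_set (fB _ xB) eq_sym (negPf j0) andbF.
apply/setP => W; rewrite !in_setU -orbA; congr (_ || _).
apply/orP/imsetP => [[/set1P ->|/imsetP[j]]|[j _ ->]].
- by exists 0.
- by rewrite in_setC1 => j0 ->; exists j; rewrite ?cE.
have [->|j0] := eqVneq j 0; first by left; rewrite in_set1.
by right; apply/imsetP; exists j; rewrite ?in_setC1 ?cE.
Qed.

End ComplexRoot.

Theorem theorem3 (R : realType) (p n r : nat) (f : 'rV['F_p]_n -> 'F_p)
  (p_prime : prime p) (p_odd : odd p)
  (n_ge3 : (3 <= n)%N) (n_odd : odd n)
  (f_nwr : non_weakly_regular R f) (f_DBF : DBF R f)
  (sub1 : (p %% 4 = 1)%N ->
     is_nondegenerate_subspace r (Bplus R f) /\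
     is_nondegenerate_subspace r (Bplus R (dual R f)))
  (sub3 : (p %% 4 = 3)%N ->
     is_nondegenerate_subspace r (Bminus R f) /\
     is_nondegenerate_subspace r (Bplus R (dual R f))) :
  [/\ r = ((n + 1) %/ 2)%N -> (p %% 4 = 1)%N ->
        partition (U10 R f) [set: 'rV['F_p]_n] /\
        induces_symmetric_scheme ((3 * p + 1) %/ 2) (U10 R f),
      r = ((n + 1) %/ 2)%N -> (p %% 4 = 3)%N ->
        partition (U11 R f) [set: 'rV['F_p]_n] /\
        induces_symmetric_scheme ((3 * p + 1) %/ 2) (U11 R f),
      ((n + 1) %/ 2 < r <= n - 1)%N -> (p %% 4 = 1)%N ->
        partition (U12 R f) [set: 'rV['F_p]_n] /\
        induces_symmetric_scheme (2 * p + 1) (U12 R f) &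
      ((n + 1) %/ 2 < r <= n - 1)%N -> (p %% 4 = 3)%N ->
        partition (U13 R f) [set: 'rV['F_p]_n] /\
        induces_symmetric_scheme (2 * p + 1) (U13 R f)].
Proof.
have [[f_bent g_bent] f0 [h [h_gt0 h_coprime f_homog]]] := f_DBF.
(* Since p = 2 p./2 + 1, the residue of p modulo 4 is the parity of [p./2], which selects both B and
   the sign in [square_set]. *)
have m1 : (p %% 4 = 1)%N -> odd p./2 = false by have := p_halfE p_odd; lia.
have m3 : (p %% 4 = 3)%N -> odd p./2 = true by have := p_halfE p_odd; lia.
have square_set (s : bool) : odd p./2 = s ->
    [set j : 'F_p | (-1) ^+ p./2 * eta j == 1] = [set j | eta j == (-1) ^+ s].
  move=> ms; apply/setP => j; rewrite !in_set -signr_odd ms.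
  by case: s {ms}; rewrite ?expr0 ?expr1 ?mul1r // mulN1r eqr_oppLR.
have half p4 := half_scheme p_prime p_odd n_odd f_bent g_bent f0 h_gt0 h_coprime f_homog p4.
have big p4 := big_scheme p_prime p_odd n_odd f_bent g_bent f0 h_gt0 h_coprime f_homog p4.
split=> rE p4.
- have [Bs As] := sub1 p4; apply: half rE _ => //; first by rewrite m1.
  by rewrite (square_set _ (m1 p4)) squaresE.
- have [Bs As] := sub3 p4; apply: half rE _ => //; first by rewrite m3.
  by rewrite (square_set _ (m3 p4)) nonsquaresE.
- have [Bs As] := sub1 p4.
  by have := big r As; rewrite m1 //; apply.
- have [Bs As] := sub3 p4.
  by have := big r As; rewrite m3 //; apply.
Qed.
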